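(* Suppose that $p>0$. Then the increasing tritronquée Painlevé-II solutions $u^-_{\mathrm{TT}}(x;\tfrac12+\mathrm{i}p)$, $u^-_{\mathrm{TT}}(x;-\tfrac12+\mathrm{i}p)$, $u^+_{\mathrm{TT}}(x;\tfrac12-\mathrm{i}p)$, and $u^+_{\mathrm{TT}}(x;-\tfrac12-\mathrm{i}p)$ (defined in the context) are global solutions for $x\in\mathbb{R}$, i.e., they are analytic for $x\in\mathbb{R}$. Moreover, they have no real zeros.
   Context: The Painlevé-II equation with parameter $\alpha\in\mathbb{C}$ is $$\frac{d^2u}{dx^2}=xu+2u^3-\alpha .$$ All its solutions are meromorphic functions of $x\in\mathbb{C}$. For $\alpha\in\mathbb{C}\setminus(\mathbb{Z}+\tfrac12)$ and for each choice of sign $\pm$, $u^\pm_{\mathrm{TT}}(x;\alpha)$ denotes the increasing tritronquée solution of this equation with parameter $\alpha$, which is the unique solution with the asymptotic behavior $$u^\pm_{\mathrm{TT}}(x;\alpha)=\pm\mathrm{i}\left(\frac{x}{2}\right)^{1/2}+O(x^{-1}),\qquad x\to\infty,\quad |\arg(x)|<\tfrac23\pi$$ (principal branch of the square root). *)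

(* Defs.v *)
From Stdlib Require Import Reals.
From Coquelicot Require Import Coquelicot.

Open Scope R_scope.

Definition analytic_at (f : C -> C) (z0 : C) : Prop :=
  exists (a : nat -> C) (r : R), 0 < r /\
    forall z : C, Cmod (z - z0) < r ->
      is_pseries (K := C_AbsRing) (V := C_NormedModule) a (z - z0)%C (f z).

(* The value [f z0] at a pole is unconstrained; [g z0 <> 0] and [n >= 1]
   make the singularity a genuine one (not a removable one). *)
Definition pole_at (f : C -> C) (z0 : C) : Prop :=
  exists (n : nat) (g : C -> C) (r : R),
    (1 <= n)%nat /\ analytic_at g z0 /\ g z0 <> 0 /\ 0 < r /\
    forall z : C, z <> z0 -> Cmod (z - z0) < r ->
      f z = (g z / (z - z0) ^ n)%C.

Definition meromorphic (f : C -> C) : Prop :=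
  forall z : C, analytic_at f z \/ pole_at f z.

(* Meromorphic solution on C of u'' = x u + 2 u^3 - alpha; the equation is
   imposed at every point that is not a pole. *)
Definition painleve2_solution (alpha : C) (u : C -> C) : Prop :=
  meromorphic u /\
  forall x : C, analytic_at u x ->
    is_derive (K := C_AbsRing) (V := C_NormedModule) (C_derive u) x
      (x * u x + 2 * u x ^ 3 - alpha)%C.

(* Principal argument, with values in (-PI, PI]; irrelevant at 0. *)
Definition Carg (z : C) : R :=
  if Rle_dec 0 (Im z) then acos (Re z / Cmod z) else - acos (Re z / Cmod z).

Definition Cpolar (r t : R) : C := (r * cos t, r * sin t).

(* Principal branch of the square root. *)
Definition Csqrt (z : C) : C := Cpolar (sqrt (Cmod z)) (Carg z / 2).

(* u(x) = s i (x/2)^(1/2) + O(1/x) as x -> infinity in |arg x| < 2 PI / 3.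
   As usual for asymptotics in an open sector, the O-term is uniform on each
   closed subsector |arg x| <= 2 PI / 3 - delta, with constants that may
   depend on delta. *)
Definition tritronquee_asymptotics (s : R) (u : C -> C) : Prop :=
  forall delta : R, 0 < delta ->
  exists K r0 : R, 0 < r0 /\
    forall x : C, r0 <= Cmod x -> Rabs (Carg x) <= 2 / 3 * PI - delta ->
      Cmod (u x - s * Ci * Csqrt (x / 2)) <= K / Cmod x.

(* [is_uTT_plus alpha u] : u is the increasing tritronquee solution
   u^+_TT( . ; alpha), and similarly for [is_uTT_minus]. *)
Definition is_uTT_plus (alpha : C) (u : C -> C) : Prop :=
  painleve2_solution alpha u /\ tritronquee_asymptotics 1 u.

Definition is_uTT_minus (alpha : C) (u : C -> C) : Prop :=
  painleve2_solution alpha u /\ tritronquee_asymptotics (-1) u.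

Definition real_analytic_nonvanishing (u : C -> C) : Prop :=
  (forall x : R, analytic_at u (RtoC x)) /\
  (forall x : R, u (RtoC x) <> RtoC 0).

(* Main.v *)
Require Import Defs.
From Stdlib Require Import Reals Lra Lia Classical.
From Coquelicot Require Import Coquelicot.

Open Scope R_scope.

(** The four parameters have the form alpha = sigma / 2 + i P with sigma = 1 or
    -1 and P real, nonzero, of sign opposite to the sign s in the asymptotics
    u ~ s i (x/2)^(1/2).  Put U = sigma u, W = U' + U^2 + x/2 and
    p = sigma P.  Then the second-order equation is the system
      U' = W - U^2 - x/2,    W' = 2 U W - i p,
    where W is the Hamiltonian-type variable that solves Painleve XXXIV.

    The point is that W is real on the real axis, and so is
    2 (Im U) W = p.  Indeed let U~(z) be the conjugate of U at the conjugate
    of z, and W~ likewise.  The defects D = W - W~ and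
    P = (U - U~) (W + W~) - 2 i p satisfy the linear homogeneous system
      D' = (U + U~) D + P,    P' = M D,    M = W + W~ + (U - U~)^2,
    and the asymptotics give U + U~ = O(1/x) and M = -2 x + O(x^(-1/2)).
    In a cone around the positive axis Cauchy's estimate gains one power of x
    per derivative; read backwards the system turns D = O(x^k) into
    D = O(x^(k-3)), so D and P decay faster than every power of x
    ([bigO_D_all]).  On the axis itself the system is a slowly perturbed
    oscillator, whose energy can decay at most like a power of x
    ([real_energy_monotone]); hence D = P = 0 for large x ([defect_zero]), and
    then on the whole real interval of analyticity, by uniqueness for linear
    equations ([real_system_unique]).

    On that interval, write U = a + i b and f = -W.  The relation 2 b W = p
    prevents b and f from vanishing, and f > 0 near plus infinity because p
    times the sign of b is negative there; so f > 0 throughout.  The quantity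
      H = f |U|^2 / 2 + f^2 / 4 + x f / 4
    has derivative f / 4 > 0.  It is therefore bounded above as x decreases,
    which bounds |U| ([real_system_bounded]), while U is unbounded near a pole.
    So there is no real pole ([P34_system_global]), and U has no real zero since
    b <> 0. *)

(** * Complex derivatives and derivatives along curves *)

Notation is_Cderive := (@is_derive C_AbsRing C_NormedModule).

(** Distances are measured by [Cmod] on both sides here, whereas the uniform
    structure of the codomain is the one of the product R * R. *)
Lemma is_Cderive_eps (f : C -> C) (z l : C) :
  is_Cderive f z l <->
  (forall eps, 0 < eps -> exists d, 0 < d /\
     forall y, Cmod (y - z) < d ->
       Cmod (f y - f z - l * (y - z)) <= eps * Cmod (y - z)).
Proof.
split.
- intros [_ H] eps He.
  assert (Hz : is_filter_lim (locally (z : AbsRing_UniformSpace C_AbsRing)) z)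
    by (intros P HP; exact HP).
  destruct (H z Hz (mkposreal eps He)) as [d Hd].
  exists d; split; [apply cond_pos|]. intros y Hy. specialize (Hd y Hy).
  replace (l * (y - z))%C with ((y - z) * l)%C by ring. exact Hd.
- intros H; split.
  + apply (is_linear_scal_l (K:=C_AbsRing) (V:=C_NormedModule) l).
  + intros x Hx eps.
    apply (is_filter_lim_locally_unique (K:=C_AbsRing)
             (V:=AbsRing_NormedModule C_AbsRing)) in Hx.
    subst x.
    destruct (H eps (cond_pos eps)) as [d [Hd Hy]].
    exists (mkposreal d Hd). intros y Hb. specialize (Hy y Hb).
    replace (l * (y - z))%C with ((y - z) * l)%C in Hy by ring. exact Hy.
Qed.

(** [is_derive_mult] concerns functions with values in the ring itself, whose normed module structure differs from that of
    [C_NormedModule] in the uniform structure only; this bridges the two. *)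
Lemma is_Cderive_AbsRing (f : C -> C) (z l : C) :
  is_Cderive f z l <->
  is_derive (K := C_AbsRing) (V := AbsRing_NormedModule C_AbsRing) f z l.
Proof.
split; intros [_ H]; split; try exact H.
- apply (is_linear_scal_l (K:=C_AbsRing) (V:=AbsRing_NormedModule C_AbsRing) l).
- apply (is_linear_scal_l (K:=C_AbsRing) (V:=C_NormedModule) l).
Qed.

Lemma is_Cderive_eq (f : C -> C) (z l l' : C) :
  is_Cderive f z l -> l = l' -> is_Cderive f z l'.
Proof. now intros H <-. Qed.

Lemma is_Cderive_id (z : C) : is_Cderive (fun x : C => x) z (RtoC 1).
Proof. apply is_Cderive_AbsRing. exact (is_derive_id (K:=C_AbsRing) z). Qed.

Lemma is_Cderive_const (c z : C) : is_Cderive (fun _ : C => c) z (RtoC 0).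
Proof. exact (is_derive_const (K:=C_AbsRing) (V:=C_NormedModule) c z). Qed.

Lemma is_Cderive_plus (f g : C -> C) (z a b : C) :
  is_Cderive f z a -> is_Cderive g z b ->
  is_Cderive (fun x => f x + g x)%C z (a + b)%C.
Proof. exact (is_derive_plus (K:=C_AbsRing) (V:=C_NormedModule) f g z a b). Qed.

Lemma is_Cderive_mult (f g : C -> C) (z a b : C) :
  is_Cderive f z a -> is_Cderive g z b ->
  is_Cderive (fun x => f x * g x)%C z (a * g z + f z * b)%C.
Proof.
intros Hf Hg. apply is_Cderive_AbsRing.
apply is_Cderive_AbsRing in Hf. apply is_Cderive_AbsRing in Hg.
exact (is_derive_mult (K:=C_AbsRing) f g z a b Hf Hg Cmult_comm).
Qed.

Lemma is_Cderive_minus (f g : C -> C) (z a b : C) :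
  is_Cderive f z a -> is_Cderive g z b ->
  is_Cderive (fun x => f x - g x)%C z (a - b)%C.
Proof. exact (is_derive_minus (K:=C_AbsRing) (V:=C_NormedModule) f g z a b). Qed.

Lemma is_Cderive_scal (c : C) (f : C -> C) (z a : C) :
  is_Cderive f z a -> is_Cderive (fun x => c * f x)%C z (c * a)%C.
Proof.
intros Hf. eapply is_Cderive_eq.
- apply (is_Cderive_mult (fun _ => c) f); [apply is_Cderive_const|exact Hf].
- ring.
Qed.

Definition ex_Cderive (f : C -> C) (z : C) : Prop := exists l, is_Cderive f z l.

Lemma ex_Cderive_plus (f g : C -> C) (z : C) :
  ex_Cderive f z -> ex_Cderive g z -> ex_Cderive (fun y => f y + g y)%C z.
Proof. intros [l H] [m H']. eexists. exact (is_Cderive_plus f g z l m H H'). Qed.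

Lemma ex_Cderive_minus (f g : C -> C) (z : C) :
  ex_Cderive f z -> ex_Cderive g z -> ex_Cderive (fun y => f y - g y)%C z.
Proof. intros [l H] [m H']. eexists. exact (is_Cderive_minus f g z l m H H'). Qed.

Lemma ex_Cderive_mult (f g : C -> C) (z : C) :
  ex_Cderive f z -> ex_Cderive g z -> ex_Cderive (fun y => f y * g y)%C z.
Proof. intros [l H] [m H']. eexists. exact (is_Cderive_mult f g z l m H H'). Qed.

Lemma ex_Cderive_const (c z : C) : ex_Cderive (fun _ => c) z.
Proof. eexists. apply is_Cderive_const. Qed.

Lemma ex_Cderive_id (z : C) : ex_Cderive (fun y => y) z.
Proof. eexists. apply is_Cderive_id. Qed.

Lemma is_Cderive_continuous (f : C -> C) (z l : C) :
  is_Cderive f z l ->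
  forall eps, 0 < eps -> exists d, 0 < d /\
    forall y, Cmod (y - z) < d -> Cmod (f y - f z) < eps.
Proof.
intros H eps He. destruct (proj1 (is_Cderive_eps _ _ _) H 1 Rlt_0_1) as [d [Hd Hy]].
assert (HL := Cmod_ge_0 l).
assert (Hq : 0 < eps / (1 + Cmod l)) by (apply Rdiv_lt_0_compat; lra).
exists (Rmin d (eps / (1 + Cmod l))); split; [now apply Rmin_glb_lt|].
intros y Hyd.
assert (H1 := Rlt_le_trans _ _ _ Hyd (Rmin_l _ _)).
assert (H2 := Rlt_le_trans _ _ _ Hyd (Rmin_r _ _)).
specialize (Hy y H1).
replace (f y - f z)%C with ((f y - f z - l * (y - z)) + l * (y - z))%C by ring.
eapply Rle_lt_trans; [apply Cmod_triangle|]. rewrite Cmod_mult.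
apply Rle_lt_trans with ((1 + Cmod l) * Cmod (y - z)); [lra|].
apply (Rmult_lt_compat_l (1 + Cmod l)) in H2; [|lra].
replace ((1 + Cmod l) * (eps / (1 + Cmod l))) with eps in H2; [exact H2|].
field; lra.
Qed.

(** Reflecting a holomorphic function in the real axis gives a holomorphic
    function.  This allows complex conjugation on the real axis to be studied
    by Cauchy's estimate. *)
Lemma is_Cderive_conj (f : C -> C) (z l : C) :
  is_Cderive f (Cconj z) l -> is_Cderive (fun x => Cconj (f (Cconj x))) z (Cconj l).
Proof.
intros H. apply is_Cderive_eps. intros eps He.
destruct (proj1 (is_Cderive_eps _ _ _) H eps He) as [d [Hd Hy]].
exists d; split; [exact Hd|]. intros y Hyd.
assert (E : Cmod (Cconj y - Cconj z) = Cmod (y - z)).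
{ rewrite <- (Cmod_conj (y - z)). f_equal.
  unfold Cconj, Cminus, Cplus, Copp; simpl; f_equal; ring. }
rewrite <- E in Hyd |- *. specialize (Hy _ Hyd).
rewrite <- Cmod_conj. eapply Rle_trans; [|exact Hy]. right; f_equal.
destruct (f (Cconj y)), (f (Cconj z)), l, y, z.
unfold Cconj, Cminus, Cplus, Copp, Cmult; simpl; f_equal; ring.
Qed.

(** Stated through the coordinates, so that the rules for real functions apply
    to each of them. *)
Definition is_curve_derive (g : R -> C) (t : R) (v : C) :=
  is_derive (fun s => Re (g s)) t (Re v) /\ is_derive (fun s => Im (g s)) t (Im v).

Lemma is_derive_eps (f : R -> R) (t l : R) :
  is_derive f t l <->
  (forall eps, 0 < eps -> exists d, 0 < d /\
     forall y, Rabs (y - t) < d ->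
       Rabs (f y - f t - l * (y - t)) <= eps * Rabs (y - t)).
Proof.
split.
- intros [_ H] eps He.
  assert (Hz : is_filter_lim (locally t) t) by (intros P HP; exact HP).
  destruct (H t Hz (mkposreal eps He)) as [d Hd].
  exists d; split; [apply cond_pos|]. intros y Hy. specialize (Hd y Hy).
  replace (l * (y - t)) with ((y - t) * l) by ring. exact Hd.
- intros H; split.
  + apply (is_linear_scal_l (K:=R_AbsRing) (V:=R_NormedModule) l).
  + intros x Hx eps.
    apply (is_filter_lim_locally_unique (K:=R_AbsRing) (V:=R_NormedModule)) in Hx.
    subst x.
    destruct (H eps (cond_pos eps)) as [d [Hd Hy]].
    exists (mkposreal d Hd). intros y Hb. specialize (Hy y Hb).
    replace (l * (y - t)) with ((y - t) * l) in Hy by ring. exact Hy.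
Qed.

Lemma Rabs_Im_le (z : C) : Rabs (Im z) <= Cmod z.
Proof. eapply Rle_trans; [apply Rmax_r|apply Rmax_Cmod]. Qed.

Lemma Cmod_le_sum (z : C) : Cmod z <= Rabs (Re z) + Rabs (Im z).
Proof.
replace z with (RtoC (Re z) + Ci * RtoC (Im z))%C at 1.
- eapply Rle_trans; [apply Cmod_triangle|].
  rewrite Cmod_mult, Cmod_Ci, !Cmod_R. lra.
- destruct z; unfold RtoC, Ci, Cplus, Cmult; simpl; f_equal; ring.
Qed.

Lemma is_curve_derive_eps (g : R -> C) (t : R) (v : C) :
  is_curve_derive g t v <->
  (forall eps, 0 < eps -> exists d, 0 < d /\
     forall y, Rabs (y - t) < d ->
       Cmod (g y - g t - v * RtoC (y - t)) <= eps * Rabs (y - t)).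
Proof.
assert (ER : forall y, Re (g y - g t - v * RtoC (y - t))
                       = Re (g y) - Re (g t) - Re v * (y - t)).
{ intros y. unfold Re, Cminus, Cplus, Copp, Cmult, RtoC; simpl; ring. }
assert (EI : forall y, Im (g y - g t - v * RtoC (y - t))
                       = Im (g y) - Im (g t) - Im v * (y - t)).
{ intros y. unfold Im, Cminus, Cplus, Copp, Cmult, RtoC; simpl; ring. }
split.
- intros [H1 H2] eps He.
  destruct (proj1 (is_derive_eps _ _ _) H1 (eps / 2)) as [d1 [Hd1 K1]]; [lra|].
  destruct (proj1 (is_derive_eps _ _ _) H2 (eps / 2)) as [d2 [Hd2 K2]]; [lra|].
  exists (Rmin d1 d2); split; [now apply Rmin_glb_lt|]. intros y Hy.
  specialize (K1 y (Rlt_le_trans _ _ _ Hy (Rmin_l _ _))).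
  specialize (K2 y (Rlt_le_trans _ _ _ Hy (Rmin_r _ _))).
  eapply Rle_trans; [apply Cmod_le_sum|]. rewrite ER, EI. lra.
- intros H. split; apply is_derive_eps; intros eps He;
    destruct (H eps He) as [d [Hd K]]; exists d; (split; [exact Hd|]);
    intros y Hy; specialize (K y Hy).
  + rewrite <- ER. eapply Rle_trans; [apply re_le_Cmod|exact K].
  + rewrite <- EI. eapply Rle_trans; [apply Rabs_Im_le|exact K].
Qed.

(** The chain rule that restricts holomorphic functions to circles, rays and the
    real axis. *)
Lemma is_curve_derive_comp (f : C -> C) (g : R -> C) (t : R) (v l : C) :
  is_Cderive f (g t) l -> is_curve_derive g t v ->
  is_curve_derive (fun s => f (g s)) t (l * v)%C.
Proof.
intros Hf Hg. apply is_curve_derive_eps. intros eps He.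
assert (Hl := Cmod_ge_0 l). assert (Hv := Cmod_ge_0 v).
set (e1 := eps / 2 / (Cmod v + 1)).
assert (He1 : 0 < e1) by (apply Rdiv_lt_0_compat; lra).
destruct (proj1 (is_Cderive_eps _ _ _) Hf e1 He1) as [d1 [Hd1 K1]].
set (e2 := Rmin 1 (eps / 2 / (Cmod l + 1))).
assert (He2 : 0 < e2) by (apply Rmin_glb_lt; [lra|apply Rdiv_lt_0_compat; lra]).
destruct (proj1 (is_curve_derive_eps _ _ _) Hg e2 He2) as [d2 [Hd2 K2]].
set (d3 := d1 / (Cmod v + 1)).
assert (Hd3 : 0 < d3) by (apply Rdiv_lt_0_compat; lra).
exists (Rmin d2 d3); split; [now apply Rmin_glb_lt|]. intros y Hy.
specialize (K2 y (Rlt_le_trans _ _ _ Hy (Rmin_l _ _))).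
assert (Hy3 := Rlt_le_trans _ _ _ Hy (Rmin_r _ _)).
assert (e2 <= 1) by apply Rmin_l.
assert (e2l : e2 * (Cmod l + 1) <= eps / 2).
{ replace (eps / 2) with (eps / 2 / (Cmod l + 1) * (Cmod l + 1)) by (field; lra).
  apply Rmult_le_compat_r; [lra|apply Rmin_r]. }
assert (e1v : e1 * (Cmod v + 1) = eps / 2) by (unfold e1; field; lra).
assert (d3v : d3 * (Cmod v + 1) = d1) by (unfold d3; field; lra).
assert (Ha := Rabs_pos (y - t)).
assert (Hgy : Cmod (g y - g t) <= (Cmod v + 1) * Rabs (y - t)).
{ replace (g y - g t)%C with ((g y - g t - v * RtoC (y - t)) + v * RtoC (y - t))%C by ring.
  eapply Rle_trans; [apply Cmod_triangle|]. rewrite Cmod_mult, Cmod_R. nra. }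
assert (Hd : Cmod (g y - g t) < d1) by nra.
specialize (K1 _ Hd).
replace (f (g y) - f (g t) - l * v * RtoC (y - t))%C
  with ((f (g y) - f (g t) - l * (g y - g t)) + l * (g y - g t - v * RtoC (y - t)))%C by ring.
eapply Rle_trans; [apply Cmod_triangle|]. rewrite Cmod_mult.
assert (e1 * Cmod (g y - g t) <= eps / 2 * Rabs (y - t)).
{ rewrite <- e1v, Rmult_assoc. apply Rmult_le_compat_l; [lra|exact Hgy]. }
assert (Cmod l * Cmod (g y - g t - v * RtoC (y - t)) <= eps / 2 * Rabs (y - t)).
{ apply Rle_trans with (Cmod l * (e2 * Rabs (y - t))).
  - now apply Rmult_le_compat_l.
  - rewrite <- Rmult_assoc. apply Rmult_le_compat_r; [exact Ha|]. nra. }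
lra.
Qed.

(** * Cauchy's estimate for the derivative *)

Lemma is_derive_continuity_pt (f : R -> R) (x l : R) :
  is_derive f x l -> continuity_pt f x.
Proof.
intros H. apply continuity_pt_filterlim.
apply (ex_derive_continuous (K:=R_AbsRing) (V:=R_NormedModule)). now exists l.
Qed.

Lemma is_derive_zero_const (f : R -> R) (a b : R) :
  a <= b -> (forall t, a <= t <= b -> is_derive f t 0) -> f a = f b.
Proof.
intros Hab H.
destruct (MVT_gen f a b (fun _ => 0)) as [c [_ Hc]].
- intros x Hx. rewrite Rmin_left, Rmax_right in Hx by lra. apply H; lra.
- intros x Hx. rewrite Rmin_left, Rmax_right in Hx by lra.
  apply is_derive_continuity_pt with 0. now apply H.
- lra.
Qed.

Lemma is_derive_nonneg_incr (f df : R -> R) (a b : R) :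
  a <= b -> (forall t, a <= t <= b -> is_derive f t (df t)) ->
  (forall t, a <= t <= b -> 0 <= df t) -> f a <= f b.
Proof.
intros Hab H Hp.
destruct (MVT_gen f a b df) as [c [Hc1 Hc]].
- intros x Hx. rewrite Rmin_left, Rmax_right in Hx by lra. apply H; lra.
- intros x Hx. rewrite Rmin_left, Rmax_right in Hx by lra.
  apply is_derive_continuity_pt with (df x). now apply H.
- rewrite Rmin_left, Rmax_right in Hc1 by lra.
  specialize (Hp c Hc1). nra.
Qed.

(** Euler's equation r H' = H makes H r / r constant for r > 0; the limit at
    r = 0 identifies the constant. *)
Lemma euler_homogeneous_linear (H m : R -> R) (rad : R) :
  (forall r, Rabs r < rad -> is_derive H r (m r)) ->
  (forall r, Rabs r < rad -> r * m r = H r) ->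
  forall r, 0 < r < rad -> H r = r * m 0.
Proof.
intros HD HE r Hr.
assert (Hc : forall y, 0 < y <= r -> H y / y = H r / r).
{ intros y Hy. apply (is_derive_zero_const (fun s => H s / s)); [lra|].
  intros t Ht.
  assert (Ht' : Rabs t < rad) by (rewrite Rabs_right; lra).
  assert (E := HE t Ht').
  evar_last.
  - apply (is_derive_div H (fun s => s)); [apply HD, Ht'|apply is_derive_id|lra].
  - unfold one; simpl. rewrite <- E. field. lra. }
assert (H0 : H 0 = 0) by (rewrite <- HE; [ring|rewrite Rabs_R0; lra]).
assert (L : Rabs (H r / r - m 0) <= 0).
{ apply le_epsilon. intros eps He. rewrite Rplus_0_l.
  assert (D0 : is_derive H 0 (m 0)) by (apply HD; rewrite Rabs_R0; lra).
  destruct (proj1 (is_derive_eps _ _ _) D0 eps He) as [d [Hd K]].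
  set (y := Rmin (d / 2) r).
  assert (Hy : 0 < y) by (apply Rmin_glb_lt; lra).
  assert (Hyd : y <= d / 2) by apply Rmin_l.
  assert (Hyr : y <= r) by apply Rmin_r.
  specialize (K y). rewrite H0, !Rminus_0_r, (Rabs_right y) in K by lra.
  specialize (K ltac:(lra)). rewrite <- (Hc y) by lra.
  replace (H y / y - m 0) with ((H y - m 0 * y) * / y) by (field; lra).
  rewrite Rabs_mult, Rabs_inv, (Rabs_right y) by lra.
  apply Rmult_le_reg_r with y; [exact Hy|].
  rewrite Rmult_assoc, Rinv_l by lra. lra. }
assert (L' := Rabs_pos (H r / r - m 0)).
assert (E : H r / r - m 0 = 0).
{ destruct (Req_dec (H r / r - m 0) 0) as [e|ne]; [exact e|].
  apply Rabs_pos_lt in ne. lra. }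
replace (H r) with (r * (H r / r)) by (field; lra). f_equal. lra.
Qed.

Definition cis (t : R) : C := (cos t, sin t).

Lemma cis_opp (t : R) : (cis t * cis (- t) = 1)%C.
Proof.
unfold cis, Cmult; simpl. rewrite cos_neg, sin_neg.
assert (E := sin2_cos2 t). unfold Rsqr in E. unfold RtoC. apply injective_projections; simpl; lra.
Qed.

Lemma Cmod_cis (t : R) : Cmod (cis t) = 1.
Proof.
unfold Cmod, cis; simpl. transitivity (sqrt 1); [f_equal|apply sqrt_1].
assert (E := sin2_cos2 t). unfold Rsqr in E. lra.
Qed.

Lemma is_curve_derive_eq (g : R -> C) (t : R) (v v' : C) :
  is_curve_derive g t v -> v = v' -> is_curve_derive g t v'.
Proof. now intros H <-. Qed.

Lemma is_curve_derive_cis_opp (t : R) :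
  is_curve_derive (fun s => cis (- s)) t (- Ci * cis (- t))%C.
Proof.
split; simpl; auto_derive; trivial; unfold Re, Im; simpl; ring.
Qed.

Lemma is_curve_derive_mult (f g : R -> C) (t : R) (v w : C) :
  is_curve_derive f t v -> is_curve_derive g t w ->
  is_curve_derive (fun s => f s * g s)%C t (v * g t + f t * w)%C.
Proof.
intros [F1 F2] [G1 G2]; split.
- evar_last.
  + apply (is_derive_minus (K:=R_AbsRing) (V:=R_NormedModule)
       (fun s => Re (f s) * Re (g s)) (fun s => Im (f s) * Im (g s))).
    * apply (is_derive_mult (K:=R_AbsRing)); [exact F1|exact G1|exact Rmult_comm].
    * apply (is_derive_mult (K:=R_AbsRing)); [exact F2|exact G2|exact Rmult_comm].
  + unfold minus, plus, opp, mult, Re, Im; simpl. ring.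
- evar_last.
  + apply (is_derive_plus (K:=R_AbsRing) (V:=R_NormedModule)
       (fun s => Re (f s) * Im (g s)) (fun s => Im (f s) * Re (g s))).
    * apply (is_derive_mult (K:=R_AbsRing)); [exact F1|exact G2|exact Rmult_comm].
    * apply (is_derive_mult (K:=R_AbsRing)); [exact F2|exact G1|exact Rmult_comm].
  + unfold plus, mult, Re, Im; simpl. ring.
Qed.

Lemma is_curve_derive_const (c : C) (t : R) : is_curve_derive (fun _ => c) t (RtoC 0).
Proof. split; simpl; auto_derive; trivial. Qed.

Lemma is_curve_derive_radius (z0 c : C) (t : R) :
  is_curve_derive (fun s => z0 + RtoC s * c)%C t c.
Proof. split; simpl; auto_derive; trivial; unfold Re, Im; simpl; ring. Qed.

Lemma is_curve_derive_circle (z0 : C) (r t : R) :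
  is_curve_derive (fun s => z0 + RtoC r * cis s)%C t (RtoC r * (Ci * cis t))%C.
Proof. split; simpl; auto_derive; trivial; unfold Re, Im; simpl; ring. Qed.

Lemma Cmod_circle (z0 : C) (r t : R) : Cmod (z0 + RtoC r * cis t - z0) = Rabs r.
Proof.
replace (z0 + RtoC r * cis t - z0)%C with (RtoC r * cis t)%C by ring.
rewrite Cmod_mult, Cmod_cis, Cmod_R. ring.
Qed.

Section Cauchy.
Variables (f f' : C -> C) (z0 : C) (rad : R).
Hypothesis f_der : forall z, Cmod (z - z0) < rad -> is_Cderive f z (f' z).
Hypothesis f'_der : forall z, Cmod (z - z0) < rad -> ex_Cderive f' z.

Let h (r t : R) : R :=
  Re (f (z0 + RtoC r * cis t) * cis (- t)).
Let k (r t : R) : R := Re (f' (z0 + RtoC r * cis t)).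

Lemma circle_radial_derivative (r t : R) :
  Rabs r < rad -> is_derive (fun s => h s t) r (k r t).
Proof.
intros Hr.
assert (D := is_curve_derive_comp f (fun s => z0 + RtoC s * cis t)%C r _ _
   (f_der _ ltac:(rewrite Cmod_circle; exact Hr)) (is_curve_derive_radius z0 (cis t) r)).
assert (P := is_curve_derive_mult _ _ _ _ _ D (is_curve_derive_const (cis (- t)) r)).
apply (fun H => proj1 (is_curve_derive_eq _ _ _ (f' (z0 + RtoC r * cis t)%C) P H)).
cbv beta. rewrite <- (Cmult_assoc _ (cis t)), cis_opp. ring.
Qed.

(** The angular derivative of F(z0 + r e^(it)) e^(-it) is i times the difference
    between r F' and the function itself: this is what links the mean of f' with
    that of f over a circle. *)
Lemma circle_angular_derivative (r t : R) :
  Rabs r < rad ->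
  is_curve_derive (fun s => f (z0 + RtoC r * cis s) * cis (- s))%C t
    (Ci * (RtoC r * f' (z0 + RtoC r * cis t) - f (z0 + RtoC r * cis t) * cis (- t)))%C.
Proof.
intros Hr.
assert (D := is_curve_derive_comp f (fun s => z0 + RtoC r * cis s)%C t _ _
   (f_der _ ltac:(rewrite Cmod_circle; exact Hr)) (is_curve_derive_circle z0 r t)).
assert (P := is_curve_derive_mult _ _ _ _ _ D (is_curve_derive_cis_opp t)).
eapply is_curve_derive_eq; [exact P|]. cbv beta.
replace (f' (z0 + RtoC r * cis t) * (RtoC r * (Ci * cis t)) * cis (- t))%C
  with (f' (z0 + RtoC r * cis t) * RtoC r * Ci * (cis t * cis (- t)))%C by ring.
rewrite cis_opp. ring.
Qed.

Lemma circle_h_continuous (r t : R) : Rabs r < rad -> continuous (h r) t.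
Proof.
intros Hr. apply (ex_derive_continuous (K:=R_AbsRing) (V:=R_NormedModule)).
eexists. exact (proj1 (circle_angular_derivative r t Hr)).
Qed.

Lemma circle_k_continuous (r t : R) : Rabs r < rad -> continuous (k r) t.
Proof.
intros Hr. apply (ex_derive_continuous (K:=R_AbsRing) (V:=R_NormedModule)).
destruct (f'_der (z0 + RtoC r * cis t)%C ltac:(rewrite Cmod_circle; exact Hr)) as [l Hl].
eexists.
exact (proj1 (is_curve_derive_comp f' _ t _ _ Hl (is_curve_derive_circle z0 r t))).
Qed.

Lemma circle_k_continuous_2d (r t : R) :
  Rabs r < rad -> continuity_2d_pt k r t.
Proof.
intros Hr eps.
destruct (f'_der (z0 + RtoC r * cis t)%C ltac:(rewrite Cmod_circle; exact Hr)) as [l Hl].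
destruct (is_Cderive_continuous _ _ _ Hl eps (cond_pos eps)) as [d [Hd Kd]].
assert (C1 : continuity_2d_pt (fun u v => u * cos v) r t).
{ apply continuity_2d_pt_mult; [apply continuity_2d_pt_id1|].
  apply continuity_1d_2d_pt_comp with (g := fun _ v => v);
    [apply continuity_cos|apply continuity_2d_pt_id2]. }
assert (C2 : continuity_2d_pt (fun u v => u * sin v) r t).
{ apply continuity_2d_pt_mult; [apply continuity_2d_pt_id1|].
  apply continuity_1d_2d_pt_comp with (g := fun _ v => v);
    [apply continuity_sin|apply continuity_2d_pt_id2]. }
assert (Hd2 : 0 < d / 2) by lra.
destruct (C1 (mkposreal _ Hd2)) as [d1 K1]. destruct (C2 (mkposreal _ Hd2)) as [d2 K2].
exists (mkposreal (Rmin d1 d2) (Rmin_stable_in_posreal d1 d2)). simpl.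
intros u v Hu Hv.
specialize (K1 u v (Rlt_le_trans _ _ _ Hu (Rmin_l _ _)) (Rlt_le_trans _ _ _ Hv (Rmin_l _ _))).
specialize (K2 u v (Rlt_le_trans _ _ _ Hu (Rmin_r _ _)) (Rlt_le_trans _ _ _ Hv (Rmin_r _ _))).
simpl in K1, K2. unfold k.
eapply Rle_lt_trans; [|apply (Kd (z0 + RtoC u * cis v)%C)].
- match goal with |- _ <= Cmod ?x =>
    replace (Re (f' (z0 + RtoC u * cis v)) - Re (f' (z0 + RtoC r * cis t))) with (Re x)
      by (unfold Re, Cminus, Cplus, Copp; simpl; ring) end.
  apply re_le_Cmod.
- eapply Rle_lt_trans; [apply Cmod_le_sum|].
  match goal with |- Rabs ?a + Rabs ?b < _ =>
    replace a with (u * cos v - r * cos t) by (simpl; ring);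
    replace b with (u * sin v - r * sin t) by (simpl; ring) end.
  lra.
Qed.

Lemma circle_mean_derivative (r : R) :
  Rabs r < rad ->
  is_derive (fun s => RInt (h s) 0 (2 * PI)) r (RInt (k r) 0 (2 * PI)).
Proof.
intros Hr.
assert (L : locally r (fun s => Rabs s < rad)).
{ assert (Hp : 0 < rad - Rabs r) by lra. exists (mkposreal _ Hp). intros s Hs.
  change (Rabs (s - r) < rad - Rabs r) in Hs.
  replace s with ((s - r) + r) by ring.
  eapply Rle_lt_trans; [apply Rabs_triang|]. lra. }
assert (E : RInt (fun t => Derive (fun u => h u t) r) 0 (2 * PI) = RInt (k r) 0 (2 * PI)).
{ apply RInt_ext. intros t _. apply is_derive_unique.
  now apply circle_radial_derivative. }
rewrite <- E. apply (is_derive_RInt_param h).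
- revert L. apply filter_imp. intros s Hs t _. eexists. now apply circle_radial_derivative.
- intros t _. apply continuity_2d_pt_ext_loc with k.
  + destruct L as [d Hd]. exists d. intros u v Hu _. symmetry.
    apply is_derive_unique. apply circle_radial_derivative. now apply Hd.
  + now apply circle_k_continuous_2d.
- revert L. apply filter_imp. intros s Hs. apply (ex_RInt_continuous (h s)).
  intros t _. now apply circle_h_continuous.
Qed.

(** Integrating the angular derivative over a period gives 0.  With
    [circle_mean_derivative] this is Euler's equation for the mean of
    f e^(-it) as a function of the radius. *)
Lemma circle_mean_euler (r : R) :
  Rabs r < rad -> r * RInt (k r) 0 (2 * PI) = RInt (h r) 0 (2 * PI).
Proof.
intros Hr.
assert (Ek : ex_RInt (k r) 0 (2 * PI)).
{ apply (ex_RInt_continuous (k r)). intros t _. now apply circle_k_continuous. }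
assert (Eh : ex_RInt (h r) 0 (2 * PI)).
{ apply (ex_RInt_continuous (h r)). intros t _. now apply circle_h_continuous. }
set (g := fun s => Im (f (z0 + RtoC r * cis s) * cis (- s))%C).
assert (I : is_RInt (fun t => minus (scal r (k r t)) (h r t)) 0 (2 * PI)
                    (minus (g (2 * PI)) (g 0))).
{ apply (is_RInt_derive g).
  - intros t _. evar_last; [exact (proj2 (circle_angular_derivative r t Hr))|].
    unfold k, h, minus, plus, opp, scal, mult; simpl. unfold mult, Re, Im; simpl. ring.
  - intros t _. apply (continuous_minus (V := R_NormedModule)).
    + apply (continuous_scal_r (V := R_NormedModule)). now apply circle_k_continuous.
    + now apply circle_h_continuous. }
assert (G : g (2 * PI) = g 0).
{ unfold g. f_equal. unfold cis. rewrite !cos_neg, !sin_neg.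
  now rewrite cos_2PI, sin_2PI, cos_0, sin_0. }
apply (is_RInt_unique (V := R_CompleteNormedModule)) in I.
rewrite (RInt_minus (V := R_CompleteNormedModule)) in I;
  [|apply (ex_RInt_scal (V := R_NormedModule)), Ek|exact Eh].
rewrite (RInt_scal (V := R_CompleteNormedModule)) in I by exact Ek.
rewrite G in I. unfold minus, plus, opp, scal in I; simpl in I.
unfold mult in I; simpl in I. lra.
Qed.

(** The mean of f e^(-it) over the circle of radius r is linear in r with slope
    given by f' at the centre, and is bounded by M; take r = rad / 2. *)
Lemma Cauchy_estimate_Re (M : R) :
  0 < rad -> (forall z, Cmod (z - z0) < rad -> Cmod (f z) <= M) ->
  Rabs (Re (f' z0)) <= 2 * M / rad.
Proof.
intros HR HM. assert (HPI := PI_RGT_0).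
assert (Hr : 0 < rad / 2 < rad) by lra.
assert (E := euler_homogeneous_linear _ _ rad circle_mean_derivative circle_mean_euler _ Hr).
simpl in E.
assert (E0 : RInt (k 0) 0 (2 * PI) = 2 * PI * Re (f' z0)).
{ transitivity (RInt (fun _ => Re (f' z0)) 0 (2 * PI)).
  - apply RInt_ext. intros t _. unfold k. do 2 f_equal. ring.
  - rewrite RInt_const. unfold scal; simpl. unfold mult; simpl. ring. }
rewrite E0 in E.
assert (Ha : Rabs (rad / 2) < rad) by (rewrite Rabs_right; lra).
assert (B : Rabs (RInt (h (rad / 2)) 0 (2 * PI)) <= (2 * PI - 0) * M).
{ apply abs_RInt_le_const; [lra| |].
  - apply (ex_RInt_continuous (h (rad / 2))). intros t _. now apply circle_h_continuous.
  - intros t _. unfold h. eapply Rle_trans; [apply re_le_Cmod|].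
    rewrite Cmod_mult, Cmod_cis, Rmult_1_r. apply HM. now rewrite Cmod_circle. }
rewrite E in B.
replace (rad / 2 * (2 * PI * Re (f' z0))) with (rad * PI * Re (f' z0)) in B by field.
rewrite Rabs_mult, (Rabs_right (rad * PI)) in B by nra.
apply Rmult_le_reg_r with (rad * PI); [nra|].
replace (2 * M / rad * (rad * PI)) with (2 * PI * M) by (field; lra). lra.
Qed.

End Cauchy.

(** Obtained from the bound on real parts for f and for i f, which accounts for
    the constant 4 in place of the optimal 1. *)
Lemma Cauchy_estimate (f f' : C -> C) (z0 : C) (rad M : R) :
  0 < rad ->
  (forall z, Cmod (z - z0) < rad ->
     is_Cderive f z (f' z) /\ ex_Cderive f' z /\ Cmod (f z) <= M) ->
  Cmod (f' z0) <= 4 * M / rad.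
Proof.
intros HR H.
assert (A : Rabs (Re (f' z0)) <= 2 * M / rad).
{ apply (Cauchy_estimate_Re f); try exact HR; intros z Hz; now apply H. }
assert (B : Rabs (Re (Ci * f' z0)) <= 2 * M / rad).
{ apply (Cauchy_estimate_Re (fun z => Ci * f z)%C (fun z => Ci * f' z)%C);
    try exact HR; intros z Hz; destruct (H z Hz) as [D [[l Hl] Hb]].
  - now apply is_Cderive_scal.
  - eexists. apply is_Cderive_scal, Hl.
  - rewrite Cmod_mult, Cmod_Ci. lra. }
replace (Re (Ci * f' z0)) with (- Im (f' z0)) in B by (unfold Re, Im; simpl; ring).
rewrite Rabs_Ropp in B.
eapply Rle_trans; [apply Cmod_le_sum|].
replace (4 * M / rad) with (2 * M / rad + 2 * M / rad) by (field; lra). lra.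
Qed.

(** * Analytic points and poles *)

Lemma is_series_C_eps (b : nat -> C) (l : C) :
  is_series (K := C_AbsRing) (V := C_NormedModule) b l ->
  forall eps, 0 < eps -> exists N, forall n, (N <= n)%nat ->
    Cmod (sum_n (G := C_AbelianMonoid) b n - l) < eps.
Proof.
intros H eps He. assert (He2 : 0 < eps / 2) by lra.
destruct (H (ball (M := C_UniformSpace) l (mkposreal _ He2))) as [N HN].
{ now exists (mkposreal _ He2). }
exists N. intros n Hn. destruct (HN n Hn) as [B1 B2].
eapply Rle_lt_trans; [apply Cmod_le_sum|].
change (Rabs (Re (sum_n (G := C_AbelianMonoid) b n) - Re l) < eps / 2) in B1.
change (Rabs (Im (sum_n (G := C_AbelianMonoid) b n) - Im l) < eps / 2) in B2.
match goal with |- Rabs ?x + Rabs ?y < _ =>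
  change (Rabs (Re (sum_n (G := C_AbelianMonoid) b n) - Re l)
          + Rabs (Im (sum_n (G := C_AbelianMonoid) b n) - Im l) < eps) end.
lra.
Qed.

Lemma sum_n_C_S (b : nat -> C) (n : nat) :
  sum_n (G := C_AbelianMonoid) b (S n)
  = (sum_n (G := C_AbelianMonoid) b n + b (S n))%C.
Proof. exact (sum_Sn (G := C_AbelianMonoid) b n). Qed.

Lemma finite_bounded (b : nat -> R) (N : nat) :
  exists M, forall n, (n <= N)%nat -> b n <= M.
Proof.
induction N as [|N [M HM]].
- exists (b 0%nat). intros n Hn. replace n with 0%nat by lia. lra.
- exists (Rmax M (b (S N))). intros n Hn.
  destruct (Nat.eq_dec n (S N)) as [->|ne]; [apply Rmax_r|].
  eapply Rle_trans; [apply HM; lia|apply Rmax_l].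
Qed.

Lemma is_series_C_terms_bounded (b : nat -> C) (l : C) :
  is_series (K := C_AbsRing) (V := C_NormedModule) b l ->
  exists M, 0 <= M /\ forall n, Cmod (b n) <= M.
Proof.
intros H. destruct (is_series_C_eps b l H 1 Rlt_0_1) as [N HN].
destruct (finite_bounded (fun n => Cmod (b n)) N) as [M HM].
exists (Rmax M 2). split; [eapply Rle_trans; [|apply Rmax_r]; lra|].
intros n. destruct (Nat.le_gt_cases n N) as [Hn|Hn].
- eapply Rle_trans; [now apply HM|apply Rmax_l].
- eapply Rle_trans; [|apply Rmax_r]. destruct n as [|n]; [lia|].
  assert (A := HN n ltac:(lia)). assert (B := HN (S n) ltac:(lia)).
  rewrite sum_n_C_S in B.
  replace (b (S n)) with ((sum_n (G := C_AbelianMonoid) b n + b (S n) - l)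
     + - (sum_n (G := C_AbelianMonoid) b n - l))%C by ring.
  eapply Rle_trans; [apply Cmod_triangle|]. rewrite Cmod_opp. lra.
Qed.

Lemma pow_n_Cpow (z : C) (n : nat) : pow_n (K := C_AbsRing) z n = (z ^ n)%C.
Proof. induction n as [|n IH]; [reflexivity|]. simpl. now rewrite IH. Qed.

(** With q = |w| / rho <= 1/2 the remainder is at most M (q^2 + q^3 + ...), and
    the geometric series sums to at most 2 M q^2. *)
Lemma pseries_quadratic_remainder (a : nat -> C) (w l : C) (rho M : R) :
  0 < rho -> 0 <= M -> (forall n, Cmod (a n) * rho ^ n <= M) ->
  Cmod w <= rho / 2 ->
  is_pseries (K := C_AbsRing) (V := C_NormedModule) a w l ->
  Cmod (l - a 0%nat - a 1%nat * w) <= 2 * M / rho ^ 2 * Cmod w ^ 2.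
Proof.
intros Hrho HM Ha Hw Hl.
set (q := Cmod w / rho).
assert (Hw0 := Cmod_ge_0 w).
assert (Hq : 0 <= q <= 1 / 2).
{ split.
  - unfold q. apply Rmult_le_pos; [lra|]. left. now apply Rinv_0_lt_compat.
  - apply Rmult_le_reg_r with rho; [exact Hrho|]. unfold q.
    replace (Cmod w / rho * rho) with (Cmod w) by (field; lra). lra. }
set (b := fun k => (w ^ k * a k)%C).
assert (Hs : is_series (K := C_AbsRing) (V := C_NormedModule) b l).
{ eapply is_series_ext; [|exact Hl]. intros n. unfold b.
  now rewrite pow_n_Cpow. }
assert (Hb : forall n, Cmod (b n) <= M * q ^ n).
{ intros n. unfold b, q. rewrite Cmod_mult, Cmod_pow.
  unfold Rdiv. rewrite Rpow_mult_distr, pow_inv.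
  assert (P := pow_lt rho n Hrho). assert (Q := pow_le _ n Hw0).
  replace (Cmod w ^ n * Cmod (a n))
    with ((Cmod (a n) * rho ^ n) * (Cmod w ^ n * / rho ^ n)) by (field; lra).
  apply Rmult_le_compat_r; [|apply Ha].
  apply Rmult_le_pos; [lra|]. left. now apply Rinv_0_lt_compat. }
assert (Hind : forall n, Cmod (sum_n (G := C_AbelianMonoid) b (S n) - b 0%nat - b 1%nat)
                  <= M * q ^ 2 * (2 - 2 * (1 / 2) ^ n)).
{ induction n as [|n IH].
  - rewrite sum_n_C_S, sum_O.
    replace (b 0%nat + b 1%nat - b 0%nat - b 1%nat)%C with (RtoC 0) by ring.
    rewrite Cmod_0. simpl. lra.
  - rewrite sum_n_C_S.
    replace (sum_n (G := C_AbelianMonoid) b (S n) + b (S (S n)) - b 0%nat - b 1%nat)%C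
      with ((sum_n (G := C_AbelianMonoid) b (S n) - b 0%nat - b 1%nat) + b (S (S n)))%C
      by ring.
    eapply Rle_trans; [apply Cmod_triangle|].
    assert (B : Cmod (b (S (S n))) <= M * q ^ 2 * (1 / 2) ^ n).
    { eapply Rle_trans; [apply Hb|].
      replace (q ^ S (S n)) with (q ^ 2 * q ^ n) by (simpl; ring).
      rewrite <- Rmult_assoc. apply Rmult_le_compat_l.
      - apply Rmult_le_pos; [exact HM|]. apply pow2_ge_0.
      - now apply pow_incr. }
    change ((1 / 2) ^ S n) with (1 / 2 * (1 / 2) ^ n). lra. }
replace (2 * M / rho ^ 2 * Cmod w ^ 2) with (2 * (M * q ^ 2)) by (unfold q; field; lra).
apply le_epsilon. intros eps He.
destruct (is_series_C_eps b l Hs eps He) as [N HN].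
specialize (HN (S N) ltac:(lia)). specialize (Hind N).
replace (l - a 0%nat - a 1%nat * w)%C with
  ((sum_n (G := C_AbelianMonoid) b (S N) - b 0%nat - b 1%nat)
   + - (sum_n (G := C_AbelianMonoid) b (S N) - l))%C
  by (unfold b; simpl; ring).
eapply Rle_trans; [apply Cmod_triangle|]. rewrite Cmod_opp.
assert (P : 0 < (1 / 2) ^ N) by (apply pow_lt; lra).
assert (Q : 0 <= M * q ^ 2) by (apply Rmult_le_pos; [exact HM|apply pow2_ge_0]).
nra.
Qed.

Lemma analytic_at_quadratic (f : C -> C) (z0 : C) :
  analytic_at f z0 ->
  exists (l : C) (B rho : R), 0 <= B /\ 0 < rho /\
    forall z, Cmod (z - z0) <= rho ->
      Cmod (f z - f z0 - l * (z - z0)) <= B * Cmod (z - z0) ^ 2.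
Proof.
intros [a [r [Hr H]]].
assert (Hr2 : Cmod (z0 + RtoC (r / 2) - z0) = r / 2).
{ replace (z0 + RtoC (r / 2) - z0)%C with (RtoC (r / 2)) by ring.
  rewrite Cmod_R. apply Rabs_right. lra. }
assert (S := H (z0 + RtoC (r / 2))%C ltac:(rewrite Hr2; lra)).
apply is_series_C_terms_bounded in S. destruct S as [M [HM Hb]].
assert (Ha : forall n, Cmod (a n) * (r / 2) ^ n <= M).
{ intros n. specialize (Hb n). rewrite pow_n_Cpow in Hb.
  change (Cmod ((z0 + RtoC (r / 2) - z0) ^ n * a n) <= M) in Hb.
  rewrite Cmod_mult, Cmod_pow, Hr2 in Hb. lra. }
assert (K : forall z, Cmod (z - z0) <= r / 2 / 2 ->
   Cmod (f z - a 0%nat - a 1%nat * (z - z0)) <= 2 * M / (r / 2) ^ 2 * Cmod (z - z0) ^ 2).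
{ intros z Hz. apply pseries_quadratic_remainder; try assumption; try lra.
  apply H. lra. }
assert (E0 : f z0 = a 0%nat).
{ specialize (K z0). replace (z0 - z0)%C with (RtoC 0) in K by ring.
  rewrite Cmod_0 in K. specialize (K ltac:(lra)).
  assert (Z : Cmod (f z0 - a 0%nat) = 0).
  { apply Rle_antisym; [|apply Cmod_ge_0].
    replace (f z0 - a 0%nat)%C with (f z0 - a 0%nat - a 1%nat * 0)%C by ring.
    eapply Rle_trans; [exact K|]. simpl. lra. }
  apply Cmod_eq_0 in Z. replace (f z0) with (f z0 - a 0%nat + a 0%nat)%C by ring.
  rewrite Z. ring. }
exists (a 1%nat), (2 * M / (r / 2) ^ 2), (r / 2 / 2). repeat split.
- apply Rmult_le_pos; [lra|]. left. apply Rinv_0_lt_compat, pow_lt. lra.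
- lra.
- intros z Hz. rewrite E0. now apply K.
Qed.

Lemma analytic_at_is_Cderive (f : C -> C) (z : C) :
  analytic_at f z -> ex_Cderive f z.
Proof.
intros H. destruct (analytic_at_quadratic f z H) as [l [B [rho [HB [Hrho K]]]]].
exists l. apply is_Cderive_eps. intros eps He.
exists (Rmin rho (eps / (B + 1))). split.
- apply Rmin_glb_lt; [exact Hrho|]. apply Rdiv_lt_0_compat; lra.
- intros y Hy. assert (H1 := Rlt_le_trans _ _ _ Hy (Rmin_l _ _)).
  assert (H2 := Rlt_le_trans _ _ _ Hy (Rmin_r _ _)).
  specialize (K y ltac:(lra)). assert (P := Cmod_ge_0 (y - z)).
  apply (Rmult_lt_compat_l (B + 1)) in H2; [|lra].
  replace ((B + 1) * (eps / (B + 1))) with eps in H2 by (field; lra).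
  eapply Rle_trans; [exact K|]. simpl. rewrite Rmult_1_r, <- Rmult_assoc.
  apply Rmult_le_compat_r; [exact P|]. lra.
Qed.

Lemma analytic_at_locally_bounded (f : C -> C) (z0 : C) :
  analytic_at f z0 ->
  exists B r, 0 < r /\ forall z, Cmod (z - z0) < r -> Cmod (f z) <= B.
Proof.
intros H. destruct (analytic_at_is_Cderive f z0 H) as [l Hl].
destruct (is_Cderive_continuous f z0 l Hl 1 Rlt_0_1) as [d [Hd K]].
exists (1 + Cmod (f z0)), d. split; [exact Hd|]. intros z Hz. specialize (K z Hz).
replace (f z) with ((f z - f z0) + f z0)%C by ring.
eapply Rle_trans; [apply Cmod_triangle|]. lra.
Qed.

(** Near a pole the numerator stays away from 0, while the denominator is at most
    |z - z0| in modulus once |z - z0| <= 1. *)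
Lemma pole_at_unbounded (f : C -> C) (z0 : C) :
  pole_at f z0 ->
  forall B, exists r, 0 < r /\
    forall z, z <> z0 -> Cmod (z - z0) < r -> B < Cmod (f z).
Proof.
intros [n [g [r [Hn [Hg [Hg0 [Hr Hf]]]]]]] B.
destruct (analytic_at_is_Cderive g z0 Hg) as [l Hl].
apply Cmod_gt_0 in Hg0. set (m := Cmod (g z0)) in *.
destruct (is_Cderive_continuous g z0 l Hl (m / 2) ltac:(lra)) as [d [Hd K]].
assert (HB := Rabs_pos B).
set (e := m / 2 / (Rabs B + 1)).
assert (He : 0 < e) by (apply Rdiv_lt_0_compat; lra).
exists (Rmin (Rmin r d) (Rmin 1 e)). split.
{ repeat apply Rmin_glb_lt; lra. }
intros z Hz Hd0.
assert (H1 := Rlt_le_trans _ _ _ Hd0 (Rmin_l _ _)).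
assert (H2 := Rlt_le_trans _ _ _ Hd0 (Rmin_r _ _)).
assert (H11 := Rlt_le_trans _ _ _ H1 (Rmin_l _ _)).
assert (H12 := Rlt_le_trans _ _ _ H1 (Rmin_r _ _)).
assert (H21 := Rlt_le_trans _ _ _ H2 (Rmin_l _ _)).
assert (H22 := Rlt_le_trans _ _ _ H2 (Rmin_r _ _)).
assert (Hne : (z - z0)%C <> RtoC 0).
{ intros E. apply Hz. replace z with (z - z0 + z0)%C by ring. rewrite E. ring. }
assert (Hpos : 0 < Cmod (z - z0)) by now apply Cmod_gt_0.
rewrite (Hf z Hz H11), Cmod_div by now apply Cpow_nz.
rewrite Cmod_pow.
assert (Hgz : m / 2 < Cmod (g z)).
{ specialize (K z H12).
  assert (T : m <= Cmod (g z) + Cmod (g z - g z0)).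
  { unfold m. replace (g z0) with (g z + - (g z - g z0))%C at 1 by ring.
    eapply Rle_trans; [apply Cmod_triangle|]. rewrite Cmod_opp. lra. }
  lra. }
assert (Hpn : Cmod (z - z0) ^ n <= Cmod (z - z0)).
{ destruct n as [|n]; [lia|]. simpl.
  assert (Q : Cmod (z - z0) ^ n <= 1).
  { rewrite <- (pow1 n). apply pow_incr. lra. }
  nra. }
assert (Hpn0 : 0 < Cmod (z - z0) ^ n) by now apply pow_lt.
apply Rmult_lt_reg_r with (Cmod (z - z0) ^ n); [exact Hpn0|].
replace (Cmod (g z) / Cmod (z - z0) ^ n * Cmod (z - z0) ^ n) with (Cmod (g z))
  by (field; lra).
assert (HBe : (Rabs B + 1) * e = m / 2) by (unfold e; field; lra).
assert (B <= Rabs B) by apply Rle_abs.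
assert ((Rabs B + 1) * Cmod (z - z0) < m / 2).
{ rewrite <- HBe. apply Rmult_lt_compat_l; lra. }
nra.
Qed.

Lemma nearby_point (z : C) (r : R) :
  0 < r -> exists y, y <> z /\ Cmod (y - z) < r.
Proof.
intros Hr. exists (z + RtoC (r / 2))%C.
assert (E : Cmod (z + RtoC (r / 2) - z) = r / 2).
{ replace (z + RtoC (r / 2) - z)%C with (RtoC (r / 2)) by ring.
  rewrite Cmod_R. apply Rabs_right. lra. }
split; [|lra]. intros Ey. rewrite Ey in E at 1.
replace (z - z)%C with (RtoC 0) in E by ring. rewrite Cmod_0 in E. lra.
Qed.

(** The value prescribed at a pole is arbitrary, but values at nearby points are
    large; so boundedness on a disc excludes a pole at its centre. *)
Lemma meromorphic_analytic_of_bounded (f : C -> C) (z : C) (B r : R) :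
  meromorphic f -> 0 < r -> (forall y, Cmod (y - z) < r -> Cmod (f y) <= B) ->
  analytic_at f z.
Proof.
intros Hm Hr Hb. destruct (Hm z) as [Ha|Hp]; [exact Ha|exfalso].
destruct (pole_at_unbounded f z Hp B) as [r' [Hr' K]].
destruct (nearby_point z (Rmin r r')) as [y [Hy Hyz]]; [now apply Rmin_glb_lt|].
specialize (Hb y (Rlt_le_trans _ _ _ Hyz (Rmin_l _ _))).
specialize (K y Hy (Rlt_le_trans _ _ _ Hyz (Rmin_r _ _))). lra.
Qed.

(** The power series at z0 bounds f on a disc, and boundedness excludes poles
    there. *)
Lemma meromorphic_analytic_open (f : C -> C) (z0 : C) :
  meromorphic f -> analytic_at f z0 ->
  exists r, 0 < r /\ forall z, Cmod (z - z0) < r -> analytic_at f z.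
Proof.
intros Hm Ha. destruct (analytic_at_locally_bounded f z0 Ha) as [B [r [Hr K]]].
exists r. split; [exact Hr|]. intros z Hz.
apply meromorphic_analytic_of_bounded with B (r - Cmod (z - z0)); [exact Hm|lra|].
intros y Hy. apply K.
replace (y - z0)%C with ((y - z) + (z - z0))%C by ring.
eapply Rle_lt_trans; [apply Cmod_triangle|]. lra.
Qed.

(** * Continuation along the real axis *)

(** The Painleve-II equation for U, with W = U' + U^2 + z/2, as a first-order
    system; eliminating U gives the Painleve-XXXIV equation for W. *)
Definition P34_system (p : R) (U W : C -> C) (z : C) : Prop :=
  is_Cderive U z (W z - U z * U z - z / 2)%C /\
  is_Cderive W z (2 * U z * W z - Ci * RtoC p)%C.

Lemma is_curve_derive_RtoC (f : C -> C) (x : R) (l : C) :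
  is_Cderive f (RtoC x) l -> is_curve_derive (fun t => f (RtoC t)) x l.
Proof.
intros H. eapply is_curve_derive_eq.
- apply (is_curve_derive_comp f RtoC x (RtoC 1) l H).
  split; simpl; auto_derive; trivial.
- ring.
Qed.

(** The real and imaginary parts of [P34_system] on the real axis, for
    U = a + i b and W = c + i e. *)
Definition real_system (p : R) (a b c e : R -> R) (x : R) : Prop :=
  is_derive a x (c x - (a x * a x - b x * b x) - x / 2) /\
  is_derive b x (e x - 2 * a x * b x) /\
  is_derive c x (2 * (a x * c x - b x * e x)) /\
  is_derive e x (2 * (a x * e x + b x * c x) - p).

Lemma P34_system_real (p : R) (U W : C -> C) (x : R) :
  P34_system p U W (RtoC x) ->
  real_system p (fun t => Re (U (RtoC t))) (fun t => Im (U (RtoC t)))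
    (fun t => Re (W (RtoC t))) (fun t => Im (W (RtoC t))) x.
Proof.
intros [HU HW].
apply is_curve_derive_RtoC in HU. apply is_curve_derive_RtoC in HW.
assert (E2 : (RtoC x / 2)%C = RtoC (x / 2)).
{ now rewrite RtoC_div. }
rewrite E2 in HU.
destruct HU as [H1 H2], HW as [H3 H4].
refine (conj _ (conj _ (conj _ _))); evar_last;
  [exact H1| |exact H2| |exact H3| |exact H4|]; unfold Re, Im; simpl; ring.
Qed.

(** Together with e' = 2 a e + (2 b c - p), this is a linear homogeneous system
    for e and 2 b c - p. *)
Lemma real_system_defect_derive (p : R) (a b c e : R -> R) (x : R) :
  real_system p a b c e x ->
  is_derive (fun t => 2 * b t * c t - p) x ((2 * c x - 4 * b x * b x) * e x).
Proof.
intros [Ha [Hb [Hc He]]].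
evar_last.
- auto_derive; [|reflexivity].
  repeat split; eexists; [exact Hb|exact Hc].
- rewrite (is_derive_unique (fun x : R => b x) _ _ Hb),
    (is_derive_unique (fun x : R => c x) _ _ Hc). ring.
Qed.

(** Backward uniqueness for the linear system satisfied by e and
    q = 2 b c - p: with L large, (e^2 + q^2) exp (L t) is nondecreasing, and it
    vanishes at y. *)
Lemma real_system_unique (p : R) (a b c e : R -> R) (x y : R) :
  x <= y -> (forall t, x <= t <= y -> real_system p a b c e t) ->
  e y = 0 -> 2 * b y * c y = p -> e x = 0 /\ 2 * b x * c x = p.
Proof.
intros Hxy HS Ey By.
set (q := fun t => 2 * b t * c t - p).
set (m := fun t => 2 * c t - 4 * b t * b t).
destruct (continuity_ab_maj
  (fun t => 4 * (a t * a t) + 3 + m t * m t) x y Hxy) as [tm [Htm _]].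
{ intros t Ht. destruct (HS t Ht) as [Ha [Hb [Hc _]]].
  eapply is_derive_continuity_pt. unfold m. auto_derive; [|reflexivity].
  repeat split; eexists; eassumption. }
(* L is the rate in Gronwall's inequality: V' + L V >= 0 before weighting. *)
set (L := 4 * (a tm * a tm) + 3 + m tm * m tm) in *.
set (V := fun t => (e t * e t + q t * q t) * exp (L * t)).
assert (HV : V x <= V y).
{ apply (is_derive_nonneg_incr V (fun t =>
    (2 * e t * (2 * a t * e t + q t) + 2 * q t * (m t * e t)
     + L * (e t * e t + q t * q t)) * exp (L * t))); [exact Hxy| |].
  - intros t Ht. assert (Hq := real_system_defect_derive _ _ _ _ _ _ (HS t Ht)).
    destruct (HS t Ht) as [Ha [Hb [Hc He]]].
    fold q in Hq. fold (m t) in Hq.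
    unfold V. evar_last.
    + auto_derive; [|reflexivity]. repeat split; eexists; eassumption.
    + rewrite (is_derive_unique (fun x : R => e x) _ _ He).
      rewrite (is_derive_unique (fun x : R => q x) _ _ Hq).
      unfold q. ring.
  - intros t Ht. specialize (Htm t Ht). cbv beta in Htm.
    apply Rmult_le_pos; [|left; apply exp_pos].
    (* The cross term of the quadratic form in (e, q) has coefficient 2 k, with
       |k| <= s, and s is at most both diagonal coefficients L + 4 a and L. *)
    set (s := m t * m t + 2). set (k := 1 + m t).
    assert (B1 : 0 <= (s + k) * (e t + q t) ^ 2)
      by (apply Rmult_le_pos; [unfold s, k; nra|apply pow2_ge_0]).
    assert (B2 : 0 <= (s - k) * (e t - q t) ^ 2)
      by (apply Rmult_le_pos; [unfold s, k; nra|apply pow2_ge_0]).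
    assert (B3 : 0 <= (L + 4 * a t - s) * e t ^ 2).
    { apply Rmult_le_pos; [|apply pow2_ge_0].
      assert (P := pow2_ge_0 (2 * a t + 1)). unfold s. lra. }
    assert (B4 : 0 <= (L - s) * q t ^ 2).
    { apply Rmult_le_pos; [|apply pow2_ge_0].
      assert (P := pow2_ge_0 (a t)). unfold s. lra. }
    replace (m t) with (k - 1) by (unfold k; ring). lra. }
assert (Vy : V y = 0) by (unfold V, q; rewrite Ey, By; ring).
rewrite Vy in HV. unfold V in HV.
assert (HE := exp_pos (L * x)).
assert (S : e x * e x + q x * q x <= 0) by nra.
assert (e x = 0) by nra. assert (q x = 0) by nra.
unfold q in *. split; lra.
Qed.

(** Since 2 b c = p <> 0, the function c has no zero and keeps its sign. *)
Lemma real_system_negative (p : R) (a b c e : R -> R) (x y : R) :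
  p <> 0 -> x <= y ->
  (forall t, x <= t <= y -> real_system p a b c e t) ->
  (forall t, x <= t <= y -> 2 * b t * c t = p) ->
  c y < 0 -> c x < 0.
Proof.
intros Hp Hxy HS HT Hy.
destruct (Rlt_le_dec (c x) 0) as [h|h]; [exact h|exfalso].
assert (Hx : 0 < c x).
{ destruct h as [h|h]; [exact h|]. exfalso. apply Hp.
  rewrite <- (HT x), <- h by lra. ring. }
assert (Hlt : x < y) by (destruct Hxy as [l|l]; [exact l|subst; lra]).
destruct (Ranalysis5.IVT_interv (fun t => - c t) x y) as [z [Hz1 Hz2]]; try lra.
- intros t Ht. destruct (HS t Ht) as [_ [_ [Hc _]]].
  eapply is_derive_continuity_pt. auto_derive; [|reflexivity].
  eexists; exact Hc.
- apply Hp. rewrite <- (HT z Hz1).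
  replace (c z) with (- - c z) by ring. rewrite Hz2. ring.
Qed.

(** A Hamiltonian: with c = - g^2 and e = 0 it is the energy
    g'^2 / 2 + p^2 / (8 g^2) + g^4 / 4 + x g^2 / 4 of a particle on the half-line
    g > 0, with a barrier at g = 0 and confined at infinity. *)
Definition energy (a b c : R -> R) (t : R) : R :=
  - c t * (a t * a t + b t * b t) / 2 + c t * c t / 4 - t * c t / 4.

Lemma energy_derive (p : R) (a b c e : R -> R) (t : R) :
  real_system p a b c e t -> e t = 0 ->
  is_derive (energy a b c) t (- c t / 4).
Proof.
intros [Ha [Hb [Hc _]]] E. unfold energy. evar_last.
- auto_derive; [|reflexivity]. repeat split; eexists; eassumption.
- rewrite (is_derive_unique (fun x : R => a x) _ _ Ha),
    (is_derive_unique (fun x : R => b x) _ _ Hb),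
    (is_derive_unique (fun x : R => c x) _ _ Hc), E. field.
Qed.

(** The energy increases with t, hence is bounded above on the interval; with
    f = - c and 4 b^2 f^2 = p^2 this bounds f |U|^2, keeps f away from 0 and so
    bounds |U|^2. *)
Lemma real_system_bounded (p : R) (a b c e : R -> R) (T X : R) :
  p <> 0 ->
  (forall t, T < t <= X -> real_system p a b c e t) ->
  (forall t, T < t <= X -> e t = 0) ->
  (forall t, T < t <= X -> 2 * b t * c t = p) ->
  (forall t, T < t <= X -> c t < 0) ->
  exists K, forall t, T < t <= X -> a t * a t + b t * b t <= K.
Proof.
intros Hp HS HE HT HC.
(* Completing the square in f^2 / 4 + T f / 4 gives f |U|^2 / 2 <= G; then
   p^2 |U|^2 = 4 b^2 f^2 |U|^2 <= 4 (f |U|^2)^2 <= 16 G^2. *)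
set (G := energy a b c X + T * T / 4).
exists (16 * (G * G) / (p * p)). intros t Ht.
assert (I : energy a b c t <= energy a b c X).
{ apply (is_derive_nonneg_incr _ (fun t => - c t / 4)); [lra| |].
  - intros s Hs. apply (energy_derive p a b c e); [apply HS; lra|apply HE; lra].
  - intros s Hs. specialize (HC s ltac:(lra)). lra. }
unfold energy at 1 in I.
assert (Hc := HC t Ht). assert (Hq := HT t Ht).
set (f := - c t) in *. assert (Hf : 0 < f) by (unfold f; lra).
replace (c t) with (- f) in I, Hq by (unfold f; ring).
set (s := a t * a t + b t * b t) in *.
assert (Hs : b t * b t <= s) by (unfold s; assert (0 <= a t * a t) by nra; lra).
assert (Hb2 : 0 <= b t * b t) by nra.
assert (HpG : p * p = 4 * (b t * b t) * (f * f)) by (rewrite <- Hq; ring).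
assert (Hfs : f * s / 2 <= G).
{ unfold G. assert (T * f <= t * f) by nra.
  assert (P := pow2_ge_0 (f / 2 + T / 2)). nra. }
assert (Hp2 : 0 < p * p) by nra.
apply Rmult_le_reg_r with (p * p); [exact Hp2|].
replace (16 * (G * G) / (p * p) * (p * p)) with (16 * (G * G)) by (field; lra).
assert (Hfs0 : 0 <= f * s) by nra.
assert (S1 : s * (p * p) <= 4 * ((f * s) * (f * s))).
{ rewrite HpG.
  replace (s * (4 * (b t * b t) * (f * f))) with (4 * (f * f) * s * (b t * b t)) by ring.
  replace (4 * (f * s * (f * s))) with (4 * (f * f) * s * s) by ring.
  apply Rmult_le_compat_l; [|exact Hs].
  assert (0 <= f * f) by nra. assert (0 <= s) by lra.
  apply Rmult_le_pos; lra. }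
assert (S2 : (f * s) * (f * s) <= (2 * G) * (2 * G)) by nra.
lra.
Qed.

(** At the largest real point T that is not good, U would be unbounded from the
    right, against [real_system_bounded]. *)
Theorem P34_system_global (p : R) (good : C -> Prop) (U W : C -> C) (X : R) :
  p <> 0 ->
  (forall z, good z -> P34_system p U W z) ->
  (forall z, good z -> exists r, 0 < r /\ forall y, Cmod (y - z) < r -> good y) ->
  (forall z, ~ good z -> forall B, exists r, 0 < r /\
     forall y, y <> z -> Cmod (y - z) < r -> B < Cmod (U y)) ->
  (forall x, X <= x -> good (RtoC x) /\ Im (W (RtoC x)) = 0 /\
     2 * Im (U (RtoC x)) * Re (W (RtoC x)) = p /\ Re (W (RtoC x)) < 0) ->
  forall x : R, good (RtoC x) /\ U (RtoC x) <> RtoC 0.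
Proof.
intros Hp HS Hopen Hpole HX.
set (a := fun t => Re (U (RtoC t))). set (b := fun t => Im (U (RtoC t))).
set (c := fun t => Re (W (RtoC t))). set (e := fun t => Im (W (RtoC t))).
assert (HR : forall t, good (RtoC t) -> real_system p a b c e t)
  by (intros t Ht; apply P34_system_real, HS, Ht).
assert (back : forall t, t <= X -> (forall s, t <= s <= X -> good (RtoC s)) ->
           e t = 0 /\ 2 * b t * c t = p).
{ intros t Ht Hg. apply (real_system_unique p a b c e t X Ht).
  - intros s Hs. now apply HR, Hg.
  - apply (HX X). lra.
  - apply (HX X). lra. }
assert (Hgood : forall x : R, good (RtoC x)).
{ intros x1. apply NNPP. intros Hx1.
  destruct (completeness (fun x => ~ good (RtoC x))) as [T [HT1 HT2]].
  { exists X. intros x Hx. destruct (Rle_lt_dec x X) as [h|h]; [exact h|].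
    exfalso. apply Hx. apply HX. lra. }
  { now exists x1. }
  assert (HTX : T <= X).
  { apply HT2. intros x Hx. destruct (Rle_lt_dec x X) as [h|h]; [exact h|].
    exfalso. apply Hx. apply HX. lra. }
  assert (Hdist : forall t s : R, Cmod (RtoC t - RtoC s) = Rabs (t - s)).
  { intros t s. rewrite <- RtoC_minus. apply Cmod_R. }
  assert (HgT : forall t, T < t -> good (RtoC t)).
  { intros t Ht. apply NNPP. intros Hn. specialize (HT1 t Hn). lra. }
  assert (HnT : ~ good (RtoC T)).
  { intros HgT0. destruct (Hopen _ HgT0) as [r [Hr K]].
    assert (HH : T <= T - r); [|lra].
    apply HT2. intros x Hx. assert (Hle := HT1 x Hx).
    destruct (Rle_lt_dec x (T - r)) as [h|h]; [exact h|].
    exfalso. apply Hx, K. rewrite Hdist. rewrite Rabs_left1; lra. }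
  assert (HTX' : T < X).
  { destruct HTX as [h|h]; [exact h|]. exfalso. apply HnT. apply HX. lra. }
  destruct (real_system_bounded p a b c e T X Hp) as [K HK].
  - intros t Ht. apply HR, HgT. lra.
  - intros t Ht. apply back; [lra|]. intros s Hs. apply HgT. lra.
  - intros t Ht. apply back; [lra|]. intros s Hs. apply HgT. lra.
  - intros t Ht. apply (real_system_negative p a b c e t X Hp); [lra| | |].
    + intros s Hs. apply HR, HgT. lra.
    + intros s Hs. apply back; [lra|]. intros s' Hs'. apply HgT. lra.
    + apply (HX X). lra.
  - destruct (Hpole _ HnT (Rabs K + 1)) as [r [Hr HB]].
    set (t := T + Rmin (r / 2) (X - T)).
    assert (Ht1 : Rmin (r / 2) (X - T) <= r / 2) by apply Rmin_l.
    assert (Ht2 : Rmin (r / 2) (X - T) <= X - T) by apply Rmin_r.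
    assert (Ht3 : 0 < Rmin (r / 2) (X - T)) by (apply Rmin_glb_lt; lra).
    assert (Ht : T < t <= X) by (unfold t; lra).
    specialize (HK t Ht).
    specialize (HB (RtoC t)).
    assert (Hne : RtoC t <> RtoC T).
    { intros E. apply RtoC_inj in E. lra. }
    specialize (HB Hne). rewrite Hdist in HB.
    assert (Hlt : Rabs (t - T) < r) by (rewrite Rabs_right; unfold t; lra).
    specialize (HB Hlt).
    assert (E := Cmod2_alt (U (RtoC t))).
    fold (a t) in E. fold (b t) in E.
    assert (HaK := Rle_abs K). assert (HaK0 := Rabs_pos K). nra. }
intros x. split; [apply Hgood|]. intros HU0.
assert (Hq : 2 * b x * c x = p).
{ destruct (Rle_lt_dec x X) as [h|h].
  - apply back; [exact h|]. intros; apply Hgood.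
  - apply HX. lra. }
apply Hp. rewrite <- Hq. unfold b. rewrite HU0. simpl. ring.
Qed.

(** * Orders of growth in cones around the positive real axis *)

Definition cone (theta X : R) (z : C) : Prop :=
  X < Re z /\ Rabs (Im z) < theta * Re z.

(** A filter: a property holds far out in some cone around the positive real
    axis.  The opening is existentially quantified since every use of Cauchy's
    estimate shrinks the cone. *)
Definition cone_ev (P : C -> Prop) : Prop :=
  exists theta X, 0 < theta <= 1 /\ 1 <= X /\ forall z, cone theta X z -> P z.

Lemma cone_incl (t t' X X' : R) (z : C) :
  0 < t -> t <= t' -> 0 <= X' -> X' <= X -> cone t X z -> cone t' X' z.
Proof.
intros Ht Htt HX HXX [H1 H2]. split; [lra|]. eapply Rlt_le_trans; [exact H2|].
apply Rmult_le_compat_r; lra.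
Qed.

Lemma cone_ev_imp (P Q : C -> Prop) :
  (forall z, 1 < Re z -> P z -> Q z) -> cone_ev P -> cone_ev Q.
Proof.
intros H [t [X [Ht [HX K]]]]. exists t, X. split; [exact Ht|]. split; [exact HX|].
intros z Hz. apply H; [destruct Hz; lra|now apply K].
Qed.

Lemma cone_ev_and (P Q : C -> Prop) :
  cone_ev P -> cone_ev Q -> cone_ev (fun z => P z /\ Q z).
Proof.
intros [t [X [Ht [HX K]]]] [t' [X' [Ht' [HX' K']]]].
exists (Rmin t t'), (Rmax X X').
assert (Rmin t t' <= t) by apply Rmin_l. assert (Rmin t t' <= t') by apply Rmin_r.
assert (X <= Rmax X X') by apply Rmax_l. assert (X' <= Rmax X X') by apply Rmax_r.
assert (0 < Rmin t t') by (apply Rmin_glb_lt; lra).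
split; [lra|]. split; [lra|]. intros z Hz. split; [apply K|apply K'].
- apply (cone_incl (Rmin t t') t (Rmax X X') X); lra || exact Hz.
- apply (cone_incl (Rmin t t') t' (Rmax X X') X'); lra || exact Hz.
Qed.

Lemma cone_ev_imp2 (P Q S : C -> Prop) :
  (forall z, 1 < Re z -> P z -> Q z -> S z) -> cone_ev P -> cone_ev Q -> cone_ev S.
Proof.
intros H HP HQ. apply (cone_ev_imp (fun z => P z /\ Q z)).
- intros z Hz [H1 H2]. now apply H.
- now apply cone_ev_and.
Qed.

Lemma cone_ev_far (P : C -> Prop) (X : R) :
  (forall z, X < Re z -> P z) -> cone_ev P.
Proof.
intros H. exists 1, (Rmax 1 X). split; [lra|]. split; [apply Rmax_l|].
intros z [Hz _]. apply H. eapply Rle_lt_trans; [apply Rmax_r|exact Hz].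
Qed.

Lemma cone_ev_conj (P : C -> Prop) :
  cone_ev P -> cone_ev (fun z => P (Cconj z)).
Proof.
intros [t [X [Ht [HX K]]]]. exists t, X. split; [exact Ht|]. split; [exact HX|].
intros z [H1 H2]. apply K. split; [exact H1|]. unfold Im, Cconj; simpl.
rewrite Rabs_Ropp. exact H2.
Qed.

Lemma cone_ev_real (P : C -> Prop) :
  cone_ev P -> exists X, 1 <= X /\ forall x, X < x -> P (RtoC x).
Proof.
intros [t [X [Ht [HX K]]]]. exists X. split; [exact HX|]. intros x Hx. apply K.
split; [exact Hx|]. unfold Im, Re, RtoC; simpl. rewrite Rabs_R0. nra.
Qed.

(** Measured by Re z, which is comparable to the modulus in the cones of
    [cone_ev]. *)
Definition bigO (k : R) (f : C -> C) : Prop :=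
  exists K, 0 <= K /\ cone_ev (fun z => Cmod (f z) <= K * Rpower (Re z) k).

Lemma Rpower_pos (x k : R) : 0 < Rpower x k.
Proof. apply exp_pos. Qed.

Lemma bigO_ext (k : R) (f g : C -> C) :
  (forall z, 1 < Re z -> f z = g z) -> bigO k f -> bigO k g.
Proof.
intros H [K [HK HF]]. exists K. split; [exact HK|]. revert HF.
apply cone_ev_imp. intros z Hz. now rewrite (H z Hz).
Qed.

Lemma bigO_plus (k : R) (f g : C -> C) :
  bigO k f -> bigO k g -> bigO k (fun z => f z + g z)%C.
Proof.
intros [K [HK HF]] [L [HL HG]]. exists (K + L). split; [lra|]. revert HF HG.
apply cone_ev_imp2. intros z Hz A B.
eapply Rle_trans; [apply Cmod_triangle|]. lra.
Qed.

Lemma bigO_mult (k l : R) (f g : C -> C) :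
  bigO k f -> bigO l g -> bigO (k + l) (fun z => f z * g z)%C.
Proof.
intros [K [HK HF]] [L [HL HG]]. exists (K * L).
split; [now apply Rmult_le_pos|]. revert HF HG.
apply cone_ev_imp2. intros z Hz A B. rewrite Cmod_mult, Rpower_plus.
replace (K * L * (Rpower (Re z) k * Rpower (Re z) l))
  with (K * Rpower (Re z) k * (L * Rpower (Re z) l)) by ring.
apply Rmult_le_compat; try apply Cmod_ge_0; assumption.
Qed.

Lemma bigO_weaken (k l : R) (f : C -> C) : k <= l -> bigO k f -> bigO l f.
Proof.
intros Hkl [K [HK HF]]. exists K. split; [exact HK|]. revert HF.
apply cone_ev_imp. intros z Hz A. eapply Rle_trans; [exact A|].
apply Rmult_le_compat_l; [exact HK|]. destruct Hkl as [h|h].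
- left. now apply Rpower_lt.
- subst. lra.
Qed.

Lemma bigO_const (c : C) : bigO 0 (fun _ => c).
Proof.
exists (Cmod c). split; [apply Cmod_ge_0|]. apply (cone_ev_far _ 1).
intros z Hz. rewrite Rpower_O by lra. lra.
Qed.

Lemma bigO_scal (c : C) (k : R) (f : C -> C) : bigO k f -> bigO k (fun z => c * f z)%C.
Proof.
intros H. replace k with (0 + k) by ring. apply bigO_mult; [apply bigO_const|exact H].
Qed.

Lemma bigO_minus (k : R) (f g : C -> C) :
  bigO k f -> bigO k g -> bigO k (fun z => f z - g z)%C.
Proof.
intros Hf Hg. apply (bigO_ext k (fun z => f z + (-1) * g z)%C).
- intros z _. ring.
- apply bigO_plus; [exact Hf|]. now apply bigO_scal.
Qed.

Definition Cstar (f : C -> C) (z : C) : C := Cconj (f (Cconj z)).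

Lemma bigO_star (k : R) (f : C -> C) : bigO k f -> bigO k (Cstar f).
Proof.
intros [K [HK HF]]. exists K. split; [exact HK|].
apply cone_ev_conj in HF. revert HF. apply cone_ev_imp. intros z _ H.
unfold Cstar. now rewrite Cmod_conj.
Qed.

Lemma Rpower_comparable (k x y : R) :
  0 < x -> x / 2 <= y <= 2 * x -> Rpower y k <= Rpower 2 (Rabs k) * Rpower x k.
Proof.
intros Hx Hy. unfold Rpower. rewrite <- exp_plus.
assert (A : Rabs (ln y - ln x) <= ln 2).
{ apply Rabs_le. split.
  - assert (B : ln x <= ln (2 * y)).
    { destruct (Req_dec x (2 * y)) as [e|ne]; [rewrite e; lra|].
      left. apply ln_increasing; lra. }
    rewrite ln_mult in B by lra. lra.
  - assert (B : ln y <= ln (2 * x)).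
    { destruct (Req_dec y (2 * x)) as [e|ne]; [rewrite e; lra|].
      left. apply ln_increasing; lra. }
    rewrite ln_mult in B by lra. lra. }
assert (B : k * (ln y - ln x) <= Rabs k * ln 2).
{ eapply Rle_trans; [apply Rle_abs|]. rewrite Rabs_mult.
  apply Rmult_le_compat_l; [apply Rabs_pos|exact A]. }
destruct (Req_dec (k * ln y) (Rabs k * ln 2 + k * ln x)) as [e|ne]; [rewrite e; lra|].
left. apply exp_increasing. lra.
Qed.

(** Cauchy's estimate on a disc of radius proportional to Re z, which fits into
    the cone when its centre lies in the cone of half the opening; on that disc
    Re varies by a factor at most 2. *)
Lemma bigO_derive (k : R) (f f' : C -> C) :
  cone_ev (fun z => is_Cderive f z (f' z)) ->
  cone_ev (ex_Cderive f') ->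
  bigO k f -> bigO (k - 1) f'.
Proof.
intros D1 D2 [K [HK HF]].
destruct (cone_ev_and _ _ (cone_ev_and _ _ D1 D2) HF) as [t [X [Ht [HX A]]]].
set (Kk := Rpower 2 (Rabs k)).
assert (HKk : 0 < Kk) by apply Rpower_pos.
exists (16 * (K * Kk) / t). split.
{ apply Rmult_le_pos; [nra|]. left. apply Rinv_0_lt_compat. lra. }
exists (t / 2), (2 * X). split; [lra|]. split; [lra|].
intros z [Hz1 Hz2]. set (x := Re z) in *.
assert (Hx : 0 < x) by lra.
assert (E : 16 * (K * Kk) / t * Rpower x (k - 1)
            = 4 * (K * (Kk * Rpower x k)) / (t / 4 * x)).
{ unfold Rminus. rewrite Rpower_plus, Rpower_Ropp, Rpower_1 by exact Hx. field. lra. }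
rewrite E. apply (Cauchy_estimate f f'); [nra|].
intros y Hy.
assert (R1 : Rabs (Re y - x) < t / 4 * x).
{ eapply Rle_lt_trans; [|exact Hy]. eapply Rle_trans; [|apply re_le_Cmod].
  right. reflexivity. }
assert (R2 : Rabs (Im y - Im z) < t / 4 * x).
{ eapply Rle_lt_trans; [|exact Hy]. eapply Rle_trans; [|apply Rabs_Im_le].
  right. reflexivity. }
apply Rabs_def2 in R1.
assert (Hy' : Rabs (Im y) < t / 4 * x + t / 2 * x).
{ replace (Im y) with ((Im y - Im z) + Im z) by ring.
  eapply Rle_lt_trans; [apply Rabs_triang|]. lra. }
assert (tx : t * x <= x) by nra.
assert (Hcy : cone t X y).
{ split; [lra|]. eapply Rlt_le_trans; [exact Hy'|].
  assert (0 <= t * (Re y - 3 / 4 * x)) by (apply Rmult_le_pos; lra). lra. }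
destruct (A y Hcy) as [[B1 B2] B3].
split; [exact B1|]. split; [exact B2|].
eapply Rle_trans; [exact B3|]. apply Rmult_le_compat_l; [exact HK|].
apply Rpower_comparable; lra.
Qed.

(** * The principal square root in the right half-plane *)

Lemma Rpower_half (x : R) : 0 < x -> Rpower x (1 / 2) = sqrt x.
Proof. intros H. rewrite <- Rpower_sqrt by exact H. f_equal. lra. Qed.

Lemma Carg_bound (z : C) : 0 < Re z -> Rabs (Carg z) <= PI / 2.
Proof.
intros H. assert (HPI := PI_RGT_0).
assert (Hm : 0 < Cmod z).
{ eapply Rlt_le_trans; [exact H|]. eapply Rle_trans; [apply Rle_abs|apply re_le_Cmod]. }
assert (Q : 0 <= Re z / Cmod z <= 1).
{ split.
  - apply Rmult_le_pos; [lra|]. left. now apply Rinv_0_lt_compat.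
  - apply Rmult_le_reg_r with (Cmod z); [exact Hm|].
    replace (Re z / Cmod z * Cmod z) with (Re z) by (field; lra).
    rewrite Rmult_1_l. eapply Rle_trans; [apply Rle_abs|apply re_le_Cmod]. }
assert (A : 0 <= acos (Re z / Cmod z) <= PI / 2).
{ split; [apply acos_bound|].
  apply Rnot_lt_le. intros h. assert (B := acos_bound (Re z / Cmod z)).
  assert (N := cos_lt_0 _ h ltac:(lra)). rewrite cos_acos in N; lra. }
unfold Carg. destruct (Rle_dec 0 (Im z)); [|rewrite Rabs_Ropp]; rewrite Rabs_right; lra.
Qed.

Lemma Cmod_Cpolar (r t : R) : 0 <= r -> Cmod (Cpolar r t) = r.
Proof.
intros H. replace (Cpolar r t) with (RtoC r * cis t)%C.
- rewrite Cmod_mult, Cmod_cis, Cmod_R, Rabs_right by lra. ring.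
- unfold Cpolar, cis, RtoC, Cmult; simpl. f_equal; ring.
Qed.

Lemma Cmod_Csqrt (z : C) : Cmod (Csqrt z) = sqrt (Cmod z).
Proof. apply Cmod_Cpolar, sqrt_pos. Qed.

(** Both branches of [Carg] give the right sign of the imaginary part because
    sin (acos q) is nonnegative. *)
Lemma Cpolar_Carg (z : C) : z <> RtoC 0 -> Cpolar (Cmod z) (Carg z) = z.
Proof.
intros Hz. apply Cmod_gt_0 in Hz.
set (q := Re z / Cmod z).
assert (HR : Cmod z * q = Re z) by (unfold q; field; lra).
assert (Hq : -1 <= q <= 1).
{ assert (B := re_le_Cmod z). apply Rabs_le_between in B. split; nra. }
assert (HI : Cmod z * sqrt (1 - q * q) = Rabs (Im z)).
{ rewrite <- (sqrt_square (Cmod z)) by lra.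
  rewrite <- sqrt_mult by nra.
  rewrite <- sqrt_Rsqr_abs. f_equal. unfold Rsqr.
  assert (E := Cmod2_alt z).
  replace (Cmod z * Cmod z * (1 - q * q)) with (Cmod z ^ 2 - (Cmod z * q) ^ 2) by ring.
  rewrite HR, E. ring. }
unfold Cpolar, Carg. fold q. apply injective_projections; simpl.
- destruct (Rle_dec 0 (Im z)); [|rewrite cos_neg]; rewrite cos_acos by exact Hq; exact HR.
- destruct (Rle_dec 0 (Im z)) as [h|h]; [|rewrite sin_neg];
    rewrite sin_acos by exact Hq; unfold Rsqr.
  + rewrite HI, Rabs_right by lra. reflexivity.
  + replace (Cmod z * - sqrt (1 - q * q)) with (- (Cmod z * sqrt (1 - q * q))) by ring.
    rewrite HI, Rabs_left by lra. unfold Im. ring.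
Qed.

Lemma Csqrt_square (z : C) : z <> RtoC 0 -> (Csqrt z * Csqrt z)%C = z.
Proof.
intros Hz. rewrite <- (Cpolar_Carg z Hz) at 3. unfold Csqrt.
assert (S := sqrt_sqrt (Cmod z) (Cmod_ge_0 z)).
set (r := sqrt (Cmod z)) in *. rewrite <- S.
replace (Carg z) with (2 * (Carg z / 2)) at 3 by field.
set (t := Carg z / 2).
unfold Cpolar, Cmult; simpl. f_equal.
- rewrite cos_2a. ring.
- rewrite sin_2a. ring.
Qed.

(** Only the negative real axis, where [Carg] equals PI on both sides, is an
    exception to this symmetry. *)
Lemma Csqrt_conj (z : C) : 0 < Re z -> Csqrt (Cconj z) = Cconj (Csqrt z).
Proof.
intros H. unfold Csqrt. rewrite Cmod_conj.
assert (E : Carg (Cconj z) = - Carg z).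
{ unfold Carg. rewrite Cmod_conj.
  replace (Re (Cconj z)) with (Re z) by reflexivity.
  replace (Im (Cconj z)) with (- Im z) by reflexivity.
  destruct (Rle_dec 0 (- Im z)) as [h|h], (Rle_dec 0 (Im z)) as [h'|h']; try lra.
  assert (I0 : Im z = 0) by lra.
  assert (M : Cmod z = Re z).
  { destruct z as [u v]. simpl in I0, H. subst v. change (u, 0) with (RtoC u).
    rewrite Cmod_R, Rabs_right by lra. reflexivity. }
  rewrite M. replace (Re z / Re z) with 1 by (field; lra). rewrite acos_1. ring. }
rewrite E. replace (- Carg z / 2) with (- (Carg z / 2)) by field.
unfold Cpolar, Cconj; simpl. rewrite cos_neg, sin_neg. f_equal. ring.
Qed.

Lemma Csqrt_RtoC (x : R) : 0 < x -> Csqrt (RtoC x) = RtoC (sqrt x).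
Proof.
intros H. unfold Csqrt, Carg. rewrite Cmod_R, Rabs_right by lra.
simpl Im. simpl Re. destruct (Rle_dec 0 0) as [_|h]; [|lra].
replace (x / x) with 1 by (field; lra). rewrite acos_1.
unfold Cpolar. replace (0 / 2) with 0 by field. rewrite cos_0, sin_0.
unfold RtoC. f_equal; ring.
Qed.

(** * Reality of W near plus infinity *)

Lemma Chalf (z : C) : (z / 2 = RtoC (1 / 2) * z)%C.
Proof. rewrite RtoC_div by lra. field. Qed.

(** Conjugation turns i p into - i p and leaves the rest of the system
    unchanged. *)
Lemma P34_system_star (p : R) (U W : C -> C) (z : C) :
  P34_system p U W (Cconj z) -> P34_system (- p) (Cstar U) (Cstar W) z.
Proof.
intros [HU HW]. apply is_Cderive_conj in HU. apply is_Cderive_conj in HW.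
split.
- eapply is_Cderive_eq; [exact HU|]. unfold Cstar. rewrite !Chalf.
  destruct (U (Cconj z)), (W (Cconj z)), z.
  unfold Cconj, Cminus, Cplus, Copp, Cmult, RtoC; simpl; f_equal; ring.
- eapply is_Cderive_eq; [exact HW|]. unfold Cstar.
  destruct (U (Cconj z)), (W (Cconj z)), z.
  unfold Cconj, Cminus, Cplus, Copp, Cmult, RtoC, Ci; simpl; f_equal; ring.
Qed.

Section Reality.
Variables (p s : R) (U W : C -> C).
Hypothesis sys : cone_ev (P34_system p U W).
Hypothesis s_sign : s * s = 1.
Hypothesis asym : bigO (-1) (fun z => U z - s * Ci * Csqrt (z / 2))%C.

Let Us : C -> C := Cstar U.
Let Ws : C -> C := Cstar W.
Let D (z : C) : C := (W z - Ws z)%C.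
Let Sg (z : C) : C := (U z + Us z)%C.
Let M (z : C) : C := (W z + Ws z + (U z - Us z) * (U z - Us z))%C.
Let P (z : C) : C := ((U z - Us z) * (W z + Ws z) - 2 * Ci * RtoC p)%C.

(** Subtracting the system for (U~, W~) from that for (U, W) gives equations in
    which every term contains D or P. *)
Lemma defect_system :
  cone_ev (fun z =>
    (is_Cderive D z (Sg z * D z + P z)%C /\ is_Cderive P z (M z * D z)%C) /\
    (ex_Cderive (fun y => Sg y * D y + P y)%C z /\ ex_Cderive (fun y => M y * D y)%C z)).
Proof.
generalize (cone_ev_conj _ sys). generalize sys. apply cone_ev_imp2.
intros z _ H H'. apply P34_system_star in H'. fold Us Ws in H'.
destruct H as [HU HW], H' as [HUs HWs].
assert (DD : is_Cderive D z (Sg z * D z + P z)%C).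
{ eapply is_Cderive_eq; [apply is_Cderive_minus; [exact HW|exact HWs]|].
  unfold Sg, D, P. rewrite RtoC_opp. ring. }
assert (DP : is_Cderive P z (M z * D z)%C).
{ eapply is_Cderive_eq.
  - apply (is_Cderive_minus (fun z => (U z - Us z) * (W z + Ws z))%C
             (fun _ => 2 * Ci * RtoC p)%C); [|apply is_Cderive_const].
    apply is_Cderive_mult;
      [apply is_Cderive_minus; [exact HU|exact HUs]
      |apply is_Cderive_plus; [exact HW|exact HWs]].
  - cbv beta. unfold M, D. rewrite RtoC_opp. ring. }
assert (EU : ex_Cderive U z) by (eexists; exact HU).
assert (EUs : ex_Cderive Us z) by (eexists; exact HUs).
assert (EW : ex_Cderive W z) by (eexists; exact HW).
assert (EWs : ex_Cderive Ws z) by (eexists; exact HWs).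
assert (ED : ex_Cderive D z) by (eexists; exact DD).
assert (EP : ex_Cderive P z) by (eexists; exact DP).
split; [now split|]. split.
- apply ex_Cderive_plus; [|exact EP]. apply ex_Cderive_mult; [|exact ED].
  now apply ex_Cderive_plus.
- apply ex_Cderive_mult; [|exact ED]. unfold M.
  apply ex_Cderive_plus; [now apply ex_Cderive_plus|].
  apply ex_Cderive_mult; now apply ex_Cderive_minus.
Qed.

Let root (z : C) : C := (s * Ci * Csqrt (z / 2))%C.
Let eps (z : C) : C := (U z - root z)%C.

Lemma Re_half (z : C) : Re (z / 2)%C = Re z / 2.
Proof. rewrite Chalf. destruct z. unfold Re, RtoC, Cmult; simpl. field. Qed.

Lemma Csqrt_half_square (z : C) :
  0 < Re z -> (Csqrt (z / 2) * Csqrt (z / 2))%C = (z / 2)%C.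
Proof.
intros H. apply Csqrt_square. intros E.
assert (E' := Re_half z). rewrite E in E'. simpl in E'. lra.
Qed.

Lemma root_square (z : C) : 0 < Re z -> (root z * root z)%C = (- (z / 2))%C.
Proof.
intros H. unfold root.
replace (s * Ci * Csqrt (z / 2) * (s * Ci * Csqrt (z / 2)))%C
  with (RtoC s * RtoC s * (Ci * Ci) * (Csqrt (z / 2) * Csqrt (z / 2)))%C by ring.
rewrite Csqrt_half_square by exact H. rewrite <- RtoC_mult, s_sign.
replace (Ci * Ci)%C with (- RtoC 1)%C.
- ring.
- unfold Ci, Cmult, Copp, RtoC; simpl. f_equal; ring.
Qed.

Lemma root_star (z : C) : 0 < Re z -> Cstar root z = (- root z)%C.
Proof.
intros H. unfold Cstar, root.
assert (E : (Cconj z / 2)%C = Cconj (z / 2)%C).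
{ rewrite !Chalf. destruct z. unfold Cconj, RtoC, Cmult; simpl. f_equal; ring. }
rewrite E, Csqrt_conj by (rewrite Re_half; lra).
destruct (Csqrt (z / 2)).
unfold Cconj, RtoC, Cmult, Ci, Copp; simpl. f_equal; ring.
Qed.

Lemma bigO_root : bigO (1 / 2) root.
Proof.
exists 1. split; [lra|]. exists 1, 1. split; [lra|]. split; [lra|].
intros z [H1 H2]. unfold root. rewrite !Cmod_mult, Cmod_Ci, Cmod_Csqrt, Cmod_R.
assert (Hs : Rabs s = 1).
{ assert (E : Rabs s * Rabs s = 1) by (rewrite <- Rabs_mult, s_sign; apply Rabs_R1).
  assert (Q := Rabs_pos s). nra. }
rewrite Hs, Rpower_half by lra. rewrite !Rmult_1_l.
apply sqrt_le_1_alt. rewrite Chalf, Cmod_mult, Cmod_R, Rabs_right by lra.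
assert (B := Cmod_le_sum z). rewrite (Rabs_right (Re z)) in B by lra. lra.
Qed.

Lemma bigO_U : bigO (1 / 2) U.
Proof.
apply (bigO_ext _ (fun z => eps z + root z)%C).
- intros z _. unfold eps. ring.
- apply bigO_plus; [|exact bigO_root]. apply (bigO_weaken (-1)); [lra|exact asym].
Qed.

(** The leading terms of U^2 and z/2 cancel, which leaves an error of order
    x^(-1) times x^(1/2); and U' has order x^(1/2 - 1) by Cauchy's estimate. *)
Lemma bigO_W : bigO (- 1 / 2) W.
Proof.
assert (DU : bigO (1 / 2 - 1) (fun z => W z - U z * U z - z / 2)%C).
{ apply (bigO_derive (1 / 2) U); [| |exact bigO_U].
  - generalize sys. apply cone_ev_imp. intros z _ [H _]. exact H.
  - generalize sys. apply cone_ev_imp. intros z _ [H H'].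
    apply ex_Cderive_minus; [apply ex_Cderive_minus|].
    + eexists; exact H'.
    + apply ex_Cderive_mult; eexists; exact H.
    + apply (ex_Cderive_mult (fun z => z) (fun _ => / 2)%C);
        [apply ex_Cderive_id|apply ex_Cderive_const]. }
apply (bigO_ext _ (fun z => (W z - U z * U z - z / 2)
                            + eps z * (eps z + 2 * root z))%C).
- intros z Hz. unfold eps.
  replace ((U z - root z) * (U z - root z + 2 * root z))%C
    with (U z * U z - root z * root z)%C by ring.
  rewrite root_square by lra. ring.
- apply bigO_plus; [apply (bigO_weaken _ (- 1 / 2)) in DU; [exact DU|lra]|].
  replace (- 1 / 2) with (-1 + 1 / 2) by field.
  apply bigO_mult; [exact asym|]. apply bigO_plus.
  + apply (bigO_weaken (-1)); [lra|exact asym].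
  + apply bigO_scal, bigO_root.
Qed.

Lemma star_eps (z : C) : 0 < Re z -> Us z = (Cstar eps z - root z)%C.
Proof.
intros H. assert (E := root_star z H). unfold Us, eps, Cstar in *.
rewrite Cminus_conj, E. ring.
Qed.

(** The square roots in U and U~ cancel since the leading term is imaginary on
    the real axis. *)
Lemma bigO_Sg : bigO (-1) Sg.
Proof.
apply (bigO_ext _ (fun z => eps z + Cstar eps z)%C).
- intros z Hz. unfold Sg. rewrite star_eps by lra. unfold eps at 1. ring.
- apply bigO_plus; [exact asym|]. apply bigO_star, asym.
Qed.

(** M is the potential of the oscillator; its leading part is
    4 (s i (z/2)^(1/2))^2 = - 2 z. *)
Lemma bigO_M : bigO (- 1 / 2) (fun z => M z + 2 * z)%C.
Proof.
set (eta := fun z => (eps z - Cstar eps z)%C).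
assert (He : bigO (-1) eta).
{ apply bigO_minus; [exact asym|]. apply bigO_star, asym. }
apply (bigO_ext _ (fun z => (W z + Ws z) + eta z * (eta z + 4 * root z))%C).
- intros z Hz. unfold M. rewrite star_eps by lra.
  replace (U z) with (eps z + root z)%C by (unfold eps; ring).
  unfold eta.
  replace ((eps z + root z - (Cstar eps z - root z))
           * (eps z + root z - (Cstar eps z - root z)))%C
    with ((eps z - Cstar eps z) * (eps z - Cstar eps z + 4 * root z)
          + 4 * (root z * root z))%C by ring.
  rewrite root_square by lra. field.
- apply bigO_plus; [apply bigO_plus; [exact bigO_W|apply bigO_star, bigO_W]|].
  replace (- 1 / 2) with (-1 + 1 / 2) by field.
  apply bigO_mult; [exact He|]. apply bigO_plus.
  + apply (bigO_weaken (-1)); [lra|exact He].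
  + apply bigO_scal, bigO_root.
Qed.

(** P = D' - (U + U~) D, and both terms gain one power. *)
Lemma bigO_P (k : R) : bigO k D -> bigO (k - 1) P.
Proof.
intros HD.
assert (H1 : bigO (k - 1) (fun z => Sg z * D z + P z)%C).
{ apply (bigO_derive k D); [| |exact HD]; generalize defect_system;
    apply cone_ev_imp; intros z _ H; apply H. }
apply (bigO_ext _ (fun z => (Sg z * D z + P z) - Sg z * D z)%C); [intros; ring|].
apply bigO_minus; [exact H1|]. replace (k - 1) with (-1 + k) by ring.
apply bigO_mult; [exact bigO_Sg|exact HD].
Qed.

(** D = P' / M, where P' gains two powers over D and the division by M one
    more. *)
Lemma bigO_D_step (k : R) : bigO k D -> bigO (k - 3) D.
Proof.
intros HD.
assert (H2 : bigO (k - 1 - 1) (fun z => M z * D z)%C).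
{ apply (bigO_derive (k - 1) P); [| |exact (bigO_P k HD)]; generalize defect_system;
    apply cone_ev_imp; intros z _ H; apply H. }
destruct H2 as [K [HK H2]]. destruct bigO_M as [B [HB HM]].
exists K. split; [exact HK|].
assert (F := cone_ev_far (fun z => B < Re z) B (fun z H => H)).
generalize (cone_ev_and _ _ F HM) H2. apply cone_ev_imp2.
intros z Hz [Hfar H1] H3.
assert (Hp : Rpower (Re z) (- 1 / 2) <= 1).
{ rewrite <- (Rpower_O (Re z)) by lra. left. apply Rpower_lt; lra. }
assert (Hb : Cmod (M z + 2 * z) <= B).
{ eapply Rle_trans; [exact H1|]. rewrite <- (Rmult_1_r B) at 2.
  now apply Rmult_le_compat_l. }
(* |M| >= 2 |z| - B, and Re z > B. *)
assert (Hlow : Re z <= Cmod (M z)).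
{ assert (T : Cmod (2 * z) <= Cmod (M z + 2 * z) + Cmod (M z)).
  { replace (2 * z)%C with ((M z + 2 * z) + - M z)%C by ring.
    eapply Rle_trans; [apply Cmod_triangle|]. rewrite Cmod_opp. apply Req_le.
    do 2 f_equal. ring. }
  rewrite Cmod_mult, Cmod_R, Rabs_right in T by lra.
  assert (R := re_le_Cmod z). rewrite Rabs_right in R by lra. lra. }
rewrite Cmod_mult in H3. assert (Q := Cmod_ge_0 (D z)).
apply Rmult_le_reg_r with (Re z); [lra|].
replace (K * Rpower (Re z) (k - 3) * Re z) with (K * Rpower (Re z) (k - 1 - 1)).
- nra.
- replace (k - 1 - 1) with (k - 3 + 1) by ring.
  rewrite Rpower_plus, Rpower_1 by lra. ring.
Qed.

Lemma bigO_D_all (n : nat) : bigO (- 3 * INR n) D.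
Proof.
induction n as [|n IH].
- simpl. rewrite Rmult_0_r. apply (bigO_weaken (- 1 / 2)); [lra|].
  apply bigO_minus; [exact bigO_W|apply bigO_star, bigO_W].
- rewrite S_INR. replace (- 3 * (INR n + 1)) with (- 3 * INR n - 3) by ring.
  now apply bigO_D_step.
Qed.

Let a (t : R) : R := Re (U (RtoC t)).
Let b (t : R) : R := Im (U (RtoC t)).
Let c (t : R) : R := Re (W (RtoC t)).
Let e (t : R) : R := Im (W (RtoC t)).
Let q (t : R) : R := 2 * b t * c t - p.
Let m (t : R) : R := 2 * c t - 4 * b t * b t.

Lemma Cconj_RtoC (x : R) : Cconj (RtoC x) = RtoC x.
Proof. unfold Cconj, RtoC; simpl. f_equal. ring. Qed.

Lemma D_on_reals (x : R) : D (RtoC x) = (2 * Ci * RtoC (e x))%C.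
Proof.
unfold D, Ws, Cstar. rewrite Cconj_RtoC. unfold e. destruct (W (RtoC x)).
unfold Cconj, Cminus, Cplus, Copp, Cmult, RtoC, Ci; simpl. f_equal; ring.
Qed.

Lemma Sg_on_reals (x : R) : Sg (RtoC x) = (2 * RtoC (a x))%C.
Proof.
unfold Sg, Us, Cstar. rewrite Cconj_RtoC. unfold a. destruct (U (RtoC x)).
unfold Cconj, Cminus, Cplus, Copp, Cmult, RtoC, Ci; simpl. f_equal; ring.
Qed.

Lemma M_on_reals (x : R) : M (RtoC x) = RtoC (m x).
Proof.
unfold M, Us, Ws, Cstar. rewrite Cconj_RtoC. unfold m, b, c.
destruct (U (RtoC x)), (W (RtoC x)).
unfold Cconj, Cminus, Cplus, Copp, Cmult, RtoC, Ci; simpl. f_equal; ring.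
Qed.

Lemma P_on_reals (x : R) : P (RtoC x) = (2 * Ci * RtoC (q x))%C.
Proof.
unfold P, Us, Ws, Cstar. rewrite Cconj_RtoC. unfold q, b, c.
destruct (U (RtoC x)), (W (RtoC x)).
unfold Cconj, Cminus, Cplus, Copp, Cmult, RtoC, Ci; simpl. f_equal; ring.
Qed.

Lemma Cmod_2_RtoC (x : R) : Cmod (2 * RtoC x) = 2 * Rabs x.
Proof. now rewrite Cmod_mult, !Cmod_R, (Rabs_right 2) by lra. Qed.

Lemma Cmod_2i_RtoC (x : R) : Cmod (2 * Ci * RtoC x) = 2 * Rabs x.
Proof. rewrite !Cmod_mult, Cmod_Ci, !Cmod_R, (Rabs_right 2) by lra. ring. Qed.

Lemma real_coefficient_bounds :
  exists L X, 0 <= L /\ 1 <= X /\ forall x, X < x ->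
    real_system p a b c e x /\ x * Rabs (a x) <= L /\ sqrt x * Rabs (m x + 2 * x) <= L.
Proof.
destruct bigO_Sg as [K [HK HS]]. destruct bigO_M as [B [HB HM]].
destruct (cone_ev_real _ (cone_ev_and _ _ sys (cone_ev_and _ _ HS HM))) as [X [HX H]].
exists (K + B), X. split; [lra|]. split; [exact HX|].
intros x Hx. destruct (H x Hx) as [H1 [H2 H3]].
split; [now apply P34_system_real|].
rewrite Sg_on_reals, Cmod_2_RtoC in H2. rewrite M_on_reals in H3.
rewrite <- RtoC_mult, <- RtoC_plus, Cmod_R in H3.
change (Re (RtoC x)) with x in H2, H3.
assert (Hs : 0 < sqrt x) by (apply sqrt_lt_R0; lra).
replace (-1) with (- (1)) in H2 by ring.
replace (- 1 / 2) with (- (1 / 2)) in H3 by field.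
rewrite Rpower_Ropp, Rpower_1 in H2 by lra.
rewrite Rpower_Ropp, Rpower_half in H3 by lra.
assert (A := Rabs_pos (a x)).
split.
- apply (Rmult_le_compat_l x) in H2; [|lra].
  replace (x * (K * / x)) with K in H2 by (field; lra). nra.
- apply (Rmult_le_compat_l (sqrt x)) in H3; [|lra].
  replace (sqrt x * (B * / sqrt x)) with B in H3 by (field; lra). lra.
Qed.

Lemma real_defect_bounds (n : nat) :
  exists K X, 0 <= K /\ 1 <= X /\ forall x, X < x ->
    Rabs (e x) <= K * Rpower x (- 3 * INR n) /\
    Rabs (q x) <= K * Rpower x (- 3 * INR n).
Proof.
assert (HD := bigO_D_all n). assert (HP := bigO_P _ HD).
apply (bigO_weaken _ (- 3 * INR n)) in HP; [|lra].
destruct HD as [K [HK HD]]. destruct HP as [B [HB HP]].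
destruct (cone_ev_real _ (cone_ev_and _ _ HD HP)) as [X [HX H]].
exists (K + B), X. split; [lra|]. split; [exact HX|].
intros x Hx. destruct (H x Hx) as [H1 H2].
rewrite D_on_reals, Cmod_2i_RtoC in H1. rewrite P_on_reals, Cmod_2i_RtoC in H2.
change (Re (RtoC x)) with x in H1, H2.
assert (A := Rabs_pos (e x)). assert (A' := Rabs_pos (q x)).
assert (R := Rpower_pos x (- 3 * INR n)).
split; nra.
Qed.

(** The energy of the oscillator e'' = - 2 x e + lower order terms.  Its
    logarithmic derivative is at least - 6 L / x because x a and
    x^(1/2) (m + 2 x) are bounded by L. *)
Lemma real_energy_monotone :
  exists L X, 0 <= L /\ 1 <= X /\ forall x y, X < x -> x <= y ->
    (2 * x * (e x * e x) + q x * q x) * Rpower x L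
    <= (2 * y * (e y * e y) + q y * q y) * Rpower y L.
Proof.
destruct real_coefficient_bounds as [L [X [HL [HX H]]]].
exists (6 * L), X. split; [lra|]. split; [exact HX|].
intros x y Hx Hxy.
apply (is_derive_nonneg_incr
  (fun t => (2 * t * (e t * e t) + q t * q t) * Rpower t (6 * L))
  (fun t => (2 * (e t * e t) + 4 * t * e t * (2 * a t * e t + q t)
             + 2 * q t * (m t * e t)
             + 6 * L / t * (2 * t * (e t * e t) + q t * q t)) * Rpower t (6 * L)));
  [exact Hxy| |].
- intros t Ht. destruct (H t ltac:(lra)) as [HS _].
  assert (Hq := real_system_defect_derive _ _ _ _ _ _ HS). fold q in Hq. fold (m t) in Hq.
  destruct HS as [_ [_ [_ He]]]. unfold Rpower.
  evar_last.
  + auto_derive; [|reflexivity].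
    repeat split; try lra; eexists; eassumption.
  + rewrite (is_derive_unique (fun x : R => e x) _ _ He).
    rewrite (is_derive_unique (fun x : R => q x) _ _ Hq).
    unfold q. field. lra.
- intros t Ht. destruct (H t ltac:(lra)) as [_ [Ha Hm]].
  apply Rmult_le_pos; [|left; apply Rpower_pos].
  assert (Ht0 : 0 < t) by lra.
  assert (Hs : 0 < sqrt t) by (apply sqrt_lt_R0; lra).
  assert (Hss : sqrt t * sqrt t = t) by (apply sqrt_sqrt; lra).
  set (r := sqrt t) in *. set (d := m t + 2 * t) in *.
  replace (m t) with (d - 2 * t) by (unfold d; ring).
  (* The bracket multiplied by t, so that only the bounded quantities t a and
     sqrt t (m + 2 t) occur. *)
  assert (T : 0 <= t * (2 * (e t * e t) + 8 * (t * a t) * (e t * e t))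
     + 2 * r * ((r * d) * (q t * e t)) + 6 * L * (2 * t * (e t * e t) + q t * q t)).
  { set (E := r * e t).
    assert (HE : t * (e t * e t) = E * E) by (unfold E; rewrite <- Hss; ring).
    assert (A1 : - L <= t * a t).
    { assert (Z := Rle_abs (- a t)). rewrite Rabs_Ropp in Z. nra. }
    assert (A2 : Rabs (r * d * (q t * E)) <= L * ((q t * q t + E * E) / 2)).
    { rewrite Rabs_mult. apply Rmult_le_compat; try apply Rabs_pos.
      - rewrite Rabs_mult, (Rabs_right r) by lra. exact Hm.
      - apply Rabs_le. assert (Z := pow2_ge_0 (q t + E)).
        assert (Z' := pow2_ge_0 (q t - E)). split; lra. }
    apply Rabs_le_between in A2.
    replace (t * (2 * (e t * e t) + 8 * (t * a t) * (e t * e t))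
       + 2 * r * ((r * d) * (q t * e t)) + 6 * L * (2 * t * (e t * e t) + q t * q t))
      with (2 * (E * E) + 8 * (t * a t + L) * (E * E) + 2 * (r * d * (q t * E))
            + 4 * L * (E * E) + 6 * L * (q t * q t)).
    - assert (0 <= E * E) by nra. assert (0 <= q t * q t) by nra.
      assert (0 <= (t * a t + L) * (E * E)) by (apply Rmult_le_pos; lra).
      assert (0 <= L * (E * E)) by nra. assert (0 <= L * (q t * q t)) by nra. lra.
    - rewrite <- HE. unfold E. ring. }
  apply Rmult_le_reg_l with t; [exact Ht0|]. rewrite Rmult_0_r.
  eapply Rle_trans; [exact T|]. right.
  replace (2 * r * (r * d * (q t * e t))) with (2 * (r * r) * d * (q t * e t)) by ring.
  rewrite Hss. field. lra.
Qed.

(** The weighted energy is nonnegative, nondecreasing and tends to 0. *)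
Lemma defect_zero :
  exists X, 1 <= X /\ forall x, X < x -> e x = 0 /\ q x = 0.
Proof.
destruct real_energy_monotone as [L [X [HL [HX H]]]].
exists X. split; [exact HX|]. intros x Hx.
set (V := fun x => 2 * x * (e x * e x) + q x * q x) in *.
(* With n > L the bounds of order - 3 (n + 1) beat the weight x^L:
   1 - 6 (n + 1) + L < - 1. *)
destruct (INR_unbounded L) as [n Hn].
destruct (real_defect_bounds (Nat.succ n)) as [K [Y [HK [HY HB]]]].
assert (Hdecay : forall y, Rmax X Y < y -> V y * Rpower y L <= 3 * (K * K) / y).
{ intros y Hy. assert (Y < y) by (eapply Rle_lt_trans; [apply Rmax_r|exact Hy]).
  destruct (HB y ltac:(lra)) as [B1 B2].
  set (r := Rpower y (- 3 * INR (Nat.succ n))) in *.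
  assert (Hr : 0 < r) by apply Rpower_pos.
  assert (E1 : e y * e y <= K * K * (r * r)).
  { apply Rabs_le_between in B1. nra. }
  assert (E2 : q y * q y <= K * K * (r * r)).
  { apply Rabs_le_between in B2. nra. }
  assert (Hz : 0 <= K * K * (r * r)) by nra.
  assert (E3 : V y <= 3 * (K * K) * (y * (r * r))) by (unfold V; nra).
  assert (E4 : y * (r * r) * Rpower y L <= / y).
  { unfold r. rewrite <- (Rpower_1 y) at 1 by lra.
    rewrite <- !Rpower_plus. rewrite <- (Rpower_1 y) at 2 by lra.
    rewrite <- Rpower_Ropp. left. apply Rpower_lt; [lra|].
    rewrite S_INR. assert (P0 := pos_INR n). lra. }
  eapply Rle_trans; [apply Rmult_le_compat_r; [left; apply Rpower_pos|exact E3]|].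
  replace (3 * (K * K) * (y * (r * r)) * Rpower y L)
    with (3 * (K * K) * (y * (r * r) * Rpower y L)) by ring.
  apply Rmult_le_compat_l; [nra|exact E4]. }
assert (HV : V x * Rpower x L <= 0).
{ apply le_epsilon. intros d Hd. rewrite Rplus_0_l.
  set (y := Rmax x (Rmax X Y) + 1 + 3 * (K * K) / d).
  assert (Hk : 0 <= 3 * (K * K) / d).
  { apply Rmult_le_pos; [nra|]. left. now apply Rinv_0_lt_compat. }
  assert (Y1 := Rmax_l x (Rmax X Y)). assert (Y2 := Rmax_r x (Rmax X Y)).
  eapply Rle_trans; [apply (H x y Hx); unfold y; lra|].
  eapply Rle_trans; [apply Hdecay; unfold y; lra|].
  assert (Hy : 0 < y) by (unfold y; lra).
  apply Rmult_le_reg_r with y; [exact Hy|].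
  replace (3 * (K * K) / y * y) with (3 * (K * K) / d * d) by (field; lra).
  rewrite (Rmult_comm d y). apply Rmult_le_compat_r; [lra|]. unfold y. lra. }
assert (HR := Rpower_pos x L).
assert (HVx : V x <= 0) by nra. unfold V in HVx.
assert (0 <= e x * e x) by nra. assert (0 <= q x * q x) by nra.
assert (0 <= x * (e x * e x)) by (apply Rmult_le_pos; lra).
assert (e x * e x = 0) by nra. assert (q x * q x = 0) by nra.
split; nra.
Qed.

Lemma Im_U_sign : exists X, 1 <= X /\ forall x, X < x -> 0 < s * b x.
Proof.
destruct asym as [K [HK HA]]. destruct (cone_ev_real _ HA) as [X [HX H]].
exists (Rmax X (2 * K * K)). assert (M1 := Rmax_l X (2 * K * K)).
assert (M2 := Rmax_r X (2 * K * K)). split; [lra|]. intros x Hx.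
specialize (H x ltac:(lra)).
assert (Hx0 : 0 < x) by lra.
assert (E2 : (RtoC x / 2)%C = RtoC (x / 2)) by now rewrite RtoC_div.
rewrite E2, Csqrt_RtoC in H by lra.
change (Re (RtoC x)) with x in H. replace (-1) with (- (1)) in H by ring.
rewrite Rpower_Ropp, Rpower_1 in H by lra.
assert (B := Rle_trans _ _ _ (Rabs_Im_le _) H).
replace (Im (U (RtoC x) - s * Ci * RtoC (sqrt (x / 2)))) with (b x - s * sqrt (x / 2)) in B
  by (unfold b, Im; simpl; ring).
set (r := sqrt (x / 2)) in *.
assert (Hr : 0 < r) by (apply sqrt_lt_R0; lra).
assert (Hrr : r * r = x / 2) by (apply sqrt_sqrt; lra).
assert (Hkr : K * / x < r).
{ apply Rmult_lt_reg_r with x; [exact Hx0|].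
  replace (K * / x * x) with K by (field; lra).
  assert (K < r) by (apply Rnot_le_lt; intros h; nra). nra. }
apply Rabs_le_between in B.
assert (s = 1 \/ s = -1) as [->| ->].
{ assert (Z : (s - 1) * (s + 1) = 0) by lra.
  apply Rmult_integral in Z. destruct Z; [left|right]; lra. }
- lra.
- lra.
Qed.

(** The sign of Im U is s, and s p < 0, so that 2 (Im U) (Re W) = p forces
    Re W < 0. *)
Lemma tritronquee_W_real_negative :
  s * p < 0 ->
  exists X, forall x, X < x ->
    Im (W (RtoC x)) = 0 /\ 2 * Im (U (RtoC x)) * Re (W (RtoC x)) = p /\
    Re (W (RtoC x)) < 0.
Proof.
intros Hsp. destruct defect_zero as [X [_ HX]]. destruct Im_U_sign as [Y [_ HY]].
exists (Rmax X Y). intros x Hx.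
destruct (HX x (Rle_lt_trans _ _ _ (Rmax_l _ _) Hx)) as [He Hq].
specialize (HY x (Rle_lt_trans _ _ _ (Rmax_r _ _) Hx)).
fold (e x) (b x) (c x). unfold q in Hq.
split; [exact He|]. split; [lra|].
assert (Z : (s * b x) * (2 * c x) < 0).
{ replace (s * b x * (2 * c x)) with (s * (2 * b x * c x)) by ring.
  replace (2 * b x * c x) with p by lra. exact Hsp. }
nra.
Qed.

End Reality.

(** * Painleve-II tritronquees *)

(** The choice delta = PI / 6 makes the sector 2 PI / 3 - delta the right
    half-plane. *)
Lemma tritronquee_half_plane (s : R) (u : C -> C) :
  tritronquee_asymptotics s u ->
  exists K X, 1 <= X /\ forall z, X < Re z ->
    Cmod (u z - s * Ci * Csqrt (z / 2)) <= K / Cmod z.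
Proof.
intros H. assert (HPI := PI_RGT_0).
destruct (H (PI / 6) ltac:(lra)) as [K [r0 [Hr0 HK]]].
exists K, (r0 + 1). split; [lra|]. intros z Hz. apply HK.
- apply Rle_trans with (Re z); [lra|].
  eapply Rle_trans; [apply Rle_abs|apply re_le_Cmod].
- eapply Rle_trans; [apply Carg_bound; lra|]. lra.
Qed.

Lemma tritronquee_bigO (s : R) (u : C -> C) :
  tritronquee_asymptotics s u ->
  bigO (-1) (fun z => u z - s * Ci * Csqrt (z / 2))%C.
Proof.
intros H. destruct (tritronquee_half_plane s u H) as [K [X [HX HK]]].
exists (Rabs K). split; [apply Rabs_pos|]. apply (cone_ev_far _ X).
intros z Hz. eapply Rle_trans; [now apply HK|].
replace (-1) with (- (1)) by ring. rewrite Rpower_Ropp, Rpower_1 by lra.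
assert (Hm : Re z <= Cmod z) by (eapply Rle_trans; [apply Rle_abs|apply re_le_Cmod]).
apply Rle_trans with (Rabs K / Cmod z).
- apply Rmult_le_compat_r; [left; apply Rinv_0_lt_compat; lra|apply Rle_abs].
- apply Rmult_le_compat_l; [apply Rabs_pos|]. apply Rinv_le_contravar; lra.
Qed.

Lemma tritronquee_analytic_far (s : R) (u : C -> C) :
  meromorphic u -> tritronquee_asymptotics s u ->
  exists X, forall z, X < Re z -> analytic_at u z.
Proof.
intros Hm H. destruct (tritronquee_half_plane s u H) as [K [X [HX HK]]].
exists (X + 1). intros z Hz.
apply (meromorphic_analytic_of_bounded u z (Rabs K + Rabs s * sqrt ((Cmod z + 1) / 2)) 1);
  [exact Hm|lra|].
intros y Hy.
assert (R1 : Rabs (Re y - Re z) < 1).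
{ eapply Rle_lt_trans; [|exact Hy]. eapply Rle_trans; [|apply re_le_Cmod].
  right. reflexivity. }
apply Rabs_def2 in R1.
assert (Hy1 : Re y <= Cmod y) by (eapply Rle_trans; [apply Rle_abs|apply re_le_Cmod]).
assert (Hyz : Cmod y <= Cmod z + 1).
{ replace y with ((y - z) + z)%C by ring. eapply Rle_trans; [apply Cmod_triangle|]. lra. }
replace (u y) with ((u y - s * Ci * Csqrt (y / 2)) + s * Ci * Csqrt (y / 2))%C by ring.
eapply Rle_trans; [apply Cmod_triangle|]. apply Rplus_le_compat.
- eapply Rle_trans; [apply HK; lra|].
  apply Rle_trans with (Rabs K * / Cmod y).
  + apply Rmult_le_compat_r; [left; apply Rinv_0_lt_compat; lra|apply Rle_abs].
  + rewrite <- (Rmult_1_r (Rabs K)) at 2. apply Rmult_le_compat_l; [apply Rabs_pos|].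
    rewrite <- Rinv_1. apply Rinv_le_contravar; lra.
- rewrite !Cmod_mult, Cmod_Ci, Cmod_Csqrt, Cmod_R, Rmult_1_r.
  apply Rmult_le_compat_l; [apply Rabs_pos|]. apply sqrt_le_1_alt.
  rewrite Chalf, Cmod_mult, Cmod_R, Rabs_right by lra. lra.
Qed.

(** The constant in W' is - sigma alpha + 1/2, which for
    alpha = sigma / 2 + i P reduces to - i sigma P since sigma^2 = 1. *)
Lemma painleve2_P34_system (sigma P : R) (u : C -> C) (z : C) :
  sigma * sigma = 1 ->
  painleve2_solution (RtoC (sigma / 2) + Ci * RtoC P)%C u -> analytic_at u z ->
  P34_system (sigma * P) (fun y => sigma * u y)%C
    (fun y => sigma * C_derive u y + u y * u y + y / 2)%C z.
Proof.
intros Hs [_ Hode] Ha. specialize (Hode z Ha).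
destruct (analytic_at_is_Cderive u z Ha) as [l Hl].
assert (E := is_C_derive_unique u z l Hl).
assert (Hs' : (RtoC sigma * RtoC sigma)%C = RtoC 1) by now rewrite <- RtoC_mult, Hs.
split.
- eapply is_Cderive_eq; [apply is_Cderive_scal, Hl|]. rewrite E.
  replace (RtoC sigma * u z * (RtoC sigma * u z))%C
    with (RtoC sigma * RtoC sigma * (u z * u z))%C by ring.
  rewrite Hs'. ring.
- eapply is_Cderive_eq.
  + apply is_Cderive_plus; [apply is_Cderive_plus|].
    * apply is_Cderive_scal, Hode.
    * apply is_Cderive_mult; exact Hl.
    * apply (is_Cderive_mult (fun y => y) (fun _ => / 2)%C);
        [apply is_Cderive_id|apply is_Cderive_const].
  + rewrite E.
    replace (2 * (RtoC sigma * u z) * (RtoC sigma * l + u z * u z + z / 2))%C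
      with (2 * (RtoC sigma * RtoC sigma) * u z * l
            + RtoC sigma * (2 * u z * u z * u z + z * u z))%C
      by field.
    rewrite Hs'.
    replace (RtoC (sigma / 2)) with (RtoC sigma / 2)%C by now rewrite RtoC_div.
    rewrite RtoC_mult.
    replace (RtoC sigma * (z * u z + 2 * u z ^ 3 - (RtoC sigma / 2 + Ci * RtoC P)))%C
      with (RtoC sigma * (z * u z + 2 * u z ^ 3)
            - (RtoC sigma * RtoC sigma) / 2 - RtoC sigma * Ci * RtoC P)%C by field.
    rewrite Hs'. simpl. field.
Qed.

(** The four tritronquees differ only in the signs sigma and s; what matters is
    that s and P are opposite. *)
Lemma tritronquee_real_analytic_nonvanishing (sigma P s : R) (u : C -> C) :
  sigma * sigma = 1 -> s * s = 1 -> s * P < 0 ->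
  painleve2_solution (RtoC (sigma / 2) + Ci * RtoC P)%C u ->
  tritronquee_asymptotics s u ->
  real_analytic_nonvanishing u.
Proof.
intros Hsig Hs HsP Hu Has.
set (U := (fun y => RtoC sigma * u y)%C).
set (W := (fun y => RtoC sigma * C_derive u y + u y * u y + y / 2)%C).
assert (Hmer : meromorphic u) by apply Hu.
assert (Hsys : forall z, analytic_at u z -> P34_system (sigma * P) U W z)
  by (intros z Hz; now apply painleve2_P34_system).
destruct (tritronquee_analytic_far s u Hmer Has) as [X0 HX0].
assert (Hasym : bigO (-1) (fun z => U z - RtoC (sigma * s) * Ci * Csqrt (z / 2))%C).
{ apply (bigO_ext _ (fun z => RtoC sigma * (u z - s * Ci * Csqrt (z / 2)))%C).
  - intros z _. unfold U. rewrite RtoC_mult. ring.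
  - apply bigO_scal, tritronquee_bigO, Has. }
destruct (tritronquee_W_real_negative (sigma * P) (sigma * s) U W) as [X1 HX1].
- apply (cone_ev_far _ X0). intros z Hz. now apply Hsys, HX0.
- replace (sigma * s * (sigma * s)) with ((sigma * sigma) * (s * s)) by ring.
  rewrite Hsig, Hs. ring.
- exact Hasym.
- replace (sigma * s * (sigma * P)) with ((sigma * sigma) * (s * P)) by ring.
  rewrite Hsig. lra.
- assert (Hsig0 : sigma <> 0) by (intros E; rewrite E in Hsig; lra).
  assert (G : forall x : R, analytic_at u (RtoC x) /\ U (RtoC x) <> RtoC 0).
  { apply (P34_system_global (sigma * P) (analytic_at u) U W (Rmax X0 X1 + 1)).
    - apply Rmult_integral_contrapositive_currified; [exact Hsig0|].
      intros E; rewrite E in HsP; lra.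
    - exact Hsys.
    - intros z Hz. now apply meromorphic_analytic_open.
    - intros z Hz B. destruct (Hmer z) as [h|h]; [contradiction|].
      destruct (pole_at_unbounded u z h B) as [r [Hr K]].
      exists r. split; [exact Hr|]. intros y Hy Hyz. unfold U.
      rewrite Cmod_mult, Cmod_R.
      assert (Ea : Rabs sigma = 1).
      { assert (E1 : Rabs sigma * Rabs sigma = 1)
          by (rewrite <- Rabs_mult, Hsig; apply Rabs_R1).
        assert (Q := Rabs_pos sigma). nra. }
      rewrite Ea, Rmult_1_l. now apply K.
    - intros x Hx. assert (M1 := Rmax_l X0 X1). assert (M2 := Rmax_r X0 X1).
      split; [apply HX0; simpl; lra|]. apply HX1. lra. }
  split; [apply G|]. intros x E. apply (proj2 (G x)). unfold U. rewrite E. ring.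
Qed.

Theorem theorem1p4 (p : R) (hp : 0 < p) :
  (forall u : C -> C, is_uTT_minus (RtoC (1 / 2) + Ci * RtoC p)%C u ->
     real_analytic_nonvanishing u) /\
  (forall u : C -> C, is_uTT_minus (RtoC (- 1 / 2) + Ci * RtoC p)%C u ->
     real_analytic_nonvanishing u) /\
  (forall u : C -> C, is_uTT_plus (RtoC (1 / 2) - Ci * RtoC p)%C u ->
     real_analytic_nonvanishing u) /\
  (forall u : C -> C, is_uTT_plus (RtoC (- 1 / 2) - Ci * RtoC p)%C u ->
     real_analytic_nonvanishing u).
Proof.
assert (E : forall x : C, (x - Ci * RtoC p = x + Ci * RtoC (- p))%C)
  by (intros x; rewrite RtoC_opp; ring).
refine (conj _ (conj _ (conj _ _))); intros u [Hu Has].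
- apply (tritronquee_real_analytic_nonvanishing 1 p (-1)); try lra; assumption.
- apply (tritronquee_real_analytic_nonvanishing (-1) p (-1)); try lra; assumption.
- rewrite E in Hu.
  apply (tritronquee_real_analytic_nonvanishing 1 (- p) 1); try lra; assumption.
- rewrite E in Hu.
  apply (tritronquee_real_analytic_nonvanishing (-1) (- p) 1); try lra; assumption.
Qed.
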